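(* Let $\kappa$ be a regular uncountable cardinal. Every omega-field of the form $\mathbb K=\mathbb R((G))_\kappa$ admits an analytic logarithm. More generally, if $\mathbf k$ is an exponential field, then every omega-field of the form $\mathbb K=\mathbf k((G))_\kappa$ admits an analytic logarithm.
   Context: An exponential field is a real closed field $\mathbf k$ with an isomorphism of ordered groups $\exp:(\mathbf k,+,0,<)\cong(\mathbf k^{>0},\cdot,1,<)$; its inverse is the logarithm of $\mathbf k$. For an ordered field $\mathbf k$ and a multiplicative ordered abelian group $G$, the Hahn field $\mathbf k((G))$ consists of formal series $\sum_{g\in G}g\,r_g$ with reverse well-ordered support, componentwise addition, Cauchy product, ordered by the sign of the leading coefficient (coefficient of the largest support element); $\mathbf k((G))_\kappa$ is the subfield of series whose support has reverse order type $<\kappa$. Write $x\prec y$ if $c|x|<|y|$ for all $c\in\mathbf k^{>0}$. In $\mathbb K=\mathbf k((G))_\kappa$ the valuation ring is $\{x:|x|\le r \text{ for some } r\in\mathbf k\}$ and $G$ is the group of monomials. A real closed field $\mathbb K$ with a convex valuation ring and a group of monomials $G\subseteq\mathbb K^{>0}$ (a subgroup containing exactly one representative of each class of the relation $x\asymp y$, i.e. $|x|\le c|y|$ and $|y|\le c|x|$ for some $c$ in the valuation ring) is an omega-field if there is an isomorphism of ordered groups $\omega:(\mathbb K,+,0,<)\cong(G,\cdot,1,<)$ (an omega-map). An analytic logarithm on $\mathbb K=\mathbf k((G))_\kappa$ is a surjective order-preserving group homomorphism $\log:(\mathbb K^{>0},\cdot)\to(\mathbb K,+)$ such that (1) it extends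 the logarithm of $\mathbf k$; (2) $\log(1+\varepsilon)=\sum_{n\ge1}(-1)^{n+1}\varepsilon^n/n$ for all $\varepsilon\prec 1$ in $\mathbb K$; (3) $\log(G)=\mathbb K^{\uparrow}:=\mathbf k((G^{>1}))\cap\mathbb K$ (the purely infinite series). *)

(* Defs.v *)
From HB Require Import structures.
From mathcomp Require Import all_boot all_order all_algebra.
From mathcomp Require Import boolp classical_sets functions cardinality fsbigop.

Set Implicit Arguments.
Unset Strict Implicit.
Unset Printing Implicit Defensive.

Import Order.TTheory GRing.Theory Num.Theory.

Local Open Scope classical_set_scope.
Local Open Scope ring_scope.

HB.mixin Record isOrderedAbelianGroup (d : Order.disp_t) G
    of Group G & Order.Total d G := {
  oag_mulC : forall x y : G, (x * y)%g = (y * x)%g;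
  oag_ltM2l : forall z x y : G, (x < y)%O -> ((z * x)%g < (z * y)%g)%O
}.

#[short(type="orderedAbelianGroupType")]
HB.structure Definition OrderedAbelianGroup (d : Order.disp_t) :=
  {G of isOrderedAbelianGroup d G & Group G & Order.Total d G}.

Definition reverse_well_ordered (d : Order.disp_t) (G : orderType d)
    (A : set G) : Prop :=
  forall B : set G, B `<=` A -> B !=set0 ->
    exists2 m, B m & forall x, B x -> (x <= m)%O.

Lemma card_le_fun T U (u0 : U) (A : set T) (B : set U) : (A #<= B)%card ->
  exists2 f : T -> U, (forall x, A x -> B (f x)) &
    (forall x y, A x -> A y -> f x = f y -> x = y).
Proof.
move=> /card_leP/unsquash f.
exists (fun x => if pselect (A x) is left p
  then set_val (f (SigSub (mem_set p))) else u0) => [x Ax|x y Ax Ay].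
  by case: pselect => // p; apply: set_valP.
case: pselect => // p; case: pselect => // q /val_inj /inj.
by rewrite !inE => /(_ I I)/(congr1 val).
Qed.

Section ReverseWellOrdered.
Context (d : Order.disp_t) (G : orderedAbelianGroupType d).
Implicit Types (A B E : set G) (x y z g : G).
Local Open Scope order_scope.
Local Open Scope group_scope.
Local Notation rwo := (@reverse_well_ordered d G).

Lemma oag_leM2l z x y : (z * x <= z * y) = (x <= y).
Proof.
apply/idP/idP; last first.
  by rewrite !le_eqVlt => /orP[/eqP->|/(oag_ltM2l z)->]; rewrite ?eqxx ?orbT.
by apply: contraTT; rewrite -!ltNge; apply: oag_ltM2l.
Qed.

Lemma oag_leM x y z t : x <= y -> z <= t -> x * z <= y * t.
Proof.
move=> xy zt; apply: (@le_trans _ _ (x * t)); first by rewrite oag_leM2l.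
by rewrite ![_ * t]oag_mulC oag_leM2l.
Qed.

Lemma oag_leV x y : (x^-1 <= y^-1) = (y <= x).
Proof.
rewrite -[LHS](oag_leM2l x) mulgV -[LHS](oag_leM2l y) mulg1.
by rewrite [x / y]oag_mulC mulVKg.
Qed.

Lemma rwo_sub A B : A `<=` B -> rwo B -> rwo A.
Proof. by move=> AB rB C CA; apply: rB => x /CA/AB. Qed.

Lemma rwo_seq A (s : nat -> G) : rwo A -> (forall n, A (s n)) ->
  exists h : nat -> nat, {homo h : i j / (i < j)%N} /\
    (forall i j, (i <= j)%N -> s (h j) <= s (h i)).
Proof.
move=> rA sA.
have /choice[nx nxP] : forall n, exists m,
    (n < m)%N /\ (forall j, (n < j)%N -> s j <= s m).
  move=> n.
  have [|| _ [m nm <-] mP] := rA [set s m | m in [set m | (n < m)%N]].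
  - by move=> _ [m _ <-].
  - by exists (s n.+1); exists n.+1 => /=.
  - by exists m; split=> // j nj; apply: mP; exists j.
pose h n := iter n.+1 nx 0%N.
have hS n : h n.+1 = nx (h n) by [].
have hlt : {homo h : i j / (i < j)%N}.
  by apply: homo_ltn => [|n]; [exact: ltn_trans | rewrite hS; case: (nxP (h n))].
exists h; split=> // i j; rewrite leq_eqVlt => /orP[/eqP->//|ij].
rewrite /h iterS; have [_ ] := nxP (iter i nx 0%N); apply.
by apply: (ltn_trans (nxP _).1 (hlt _ _ ij)).
Qed.

Lemma seq_rwo A :
  (forall s : nat -> G, (forall n, A (s n)) ->
    exists i j, (i < j)%N /\ s j <= s i) -> rwo A.
Proof.
move=> sA B BA [b Bb]; apply: contrapT => nomax.
have /choice[f fP] : forall x, exists y, B x -> B y /\ x < y.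
  move=> x; have [Bx|] := pselect (B x); last by exists x.
  apply: contrapT => /forallNP ny; apply: nomax; exists x => // y By.
  by rewrite leNgt; apply/negP => xy; apply: (ny y).
pose s n := iter n f b.
have Bs n : B (s n) by elim: n => //= n /fP[].
have slt : {homo s : i j / (i < j)%N >-> i < j}.
  apply: homo_ltn => [|n]; first exact: lt_trans.
  by have [] := fP _ (Bs n).
have [i [j [ij]]] := sA s (fun n => BA _ (Bs n)).
by rewrite leNgt slt.
Qed.

Definition gprod A B : set G := [set g | exists a b, [/\ A a, B b & g = a * b]].

Lemma rwo_gprod A B : rwo A -> rwo B -> rwo (gprod A B).
Proof.
move=> rA rB; apply: seq_rwo => s.
move=> /choice[a /choice[b abP]].
have [n|h [hlt hle]] := @rwo_seq A a rA; first by case: (abP n).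
have [n|h' [h'lt h'le]] := @rwo_seq B (b \o h) rB; first by case: (abP (h n)).
exists (h (h' 0%N)), (h (h' 1%N)); split; first by apply/hlt/h'lt.
have [_ _ ->] := abP (h (h' 1%N)); have [_ _ ->] := abP (h (h' 0%N)).
by apply: oag_leM; [apply/hle/ltnW/h'lt | apply: h'le].
Qed.

Lemma rwo_setU A B : rwo A -> rwo B -> rwo (A `|` B).
Proof.
move=> rA rB C CAB [c Cc].
have [[x [Ax Cx]]|nA] := pselect ((A `&` C) !=set0); last first.
  apply: rB => [x Cx|]; last by exists c.
  by have [Ax|//] := CAB x Cx; case: nA; exists x.
have [||m [Am Cm] mP] := rA (A `&` C); [by move=> ? []|by exists x|].
have [[y [By Cy]]|nB] := pselect ((B `&` C) !=set0); last first.
  exists m => // z Cz; have [Az|Bz] := CAB z Cz; first exact: mP.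
  by case: nB; exists z.
have [||m' [Bm' Cm'] mP'] := rB (B `&` C); [by move=> ? []|by exists y|].
exists (Order.max m m'); first by rewrite /Order.max; case: ifP.
move=> z Cz; rewrite le_max.
by have [Az|Bz] := CAB z Cz; [rewrite mP|rewrite orbC mP'].
Qed.

Lemma rwo_fiber A B g : rwo A -> rwo B ->
  finite_set [set a | A a /\ B (a^-1 * g)].
Proof.
move=> rA rB; apply: contrapT => /infiniteP /(card_le_fun 1)[a aP' ainj].
have aP n : A (a n) /\ B ((a n)^-1 * g) by apply: aP'.
have [n|h [hlt hle]] := @rwo_seq A a rA; first by case: (aP n).
have [n|h' [h'lt h'le]] := @rwo_seq B (fun n => (a (h n))^-1 * g) rB.
  by case: (aP (h n)).
have := h'le 0%N 1%N isT; rewrite ![_ * g]oag_mulC oag_leM2l oag_leV => le1.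
have le2 := hle _ _ (ltnW (h'lt 0%N 1%N isT)).
have /ainj e : a (h (h' 0%N)) = a (h (h' 1%N)) by apply: le_anti; rewrite le1 le2.
by have := hlt _ _ (h'lt 0%N 1%N isT); rewrite e // ltnn.
Qed.

Fixpoint gpow E n : set G := if n is m.+1 then gprod E (gpow E m) else [set 1].
Definition gmonoid E : set G := [set g | exists n, gpow E n g].

Lemma min_bad_seq (T : Type) (len : T -> nat) (P : (nat -> T) -> Prop) s0 :
  P s0 ->
  (forall m : nat -> T, (forall j, exists2 s, P s & forall i, (i < j)%N -> s i = m i) -> P m) ->
  exists2 m, P m &
    forall n t, P t -> (forall i, (i < n)%N -> t i = m i) -> (len (m n) <= len (t n))%N.
Proof.
move=> Ps0 Plim.
have /choice[F FP] : forall ns : nat * (nat -> T), exists s', P ns.2 ->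
    [/\ P s', forall i, (i < ns.1)%N -> s' i = ns.2 i &
    forall t, P t -> (forall i, (i < ns.1)%N -> t i = ns.2 i) ->
      (len (s' ns.1) <= len (t ns.1))%N].
  move=> [n s] /=; have [Ps|] := pselect (P s); last by exists s.
  pose Q k := `[< exists t, [/\ P t, forall i, (i < n)%N -> t i = s i & len (t n) = k] >].
  have exQ : exists k, Q k by exists (len (s n)); apply/asboolP; exists s.
  case: (ex_minnP exQ) => k /asboolP[t [Pt tP tk]] kmin.
  exists t => _; split=> // t' Pt' t'P; rewrite tk; apply: kmin.
  by apply/asboolP; exists t'.
pose S := fix S n := if n is k.+1 then F (k, S k) else s0.
have PS n : P (S n) by elim: n => //= n /(FP (n, _))[].
pose m n := S n.+1 n.
have Sm j : forall i, (i < j)%N -> S j i = m i.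
  elim: j => // j IH i; rewrite ltnS leq_eqVlt => /orP[/eqP->//|ij].
  by have [_ SP _] := FP (j, S j) (PS j); rewrite /= SP //= IH.
exists m; first by apply: Plim => j; exists (S j) => //; apply: Sm.
move=> n t Pt tm; have [_ _] := FP (n, S n) (PS n); apply=> //= i ij.
by rewrite tm // Sm.
Qed.

Lemma rwo_gmonoid E : rwo E -> (forall x, E x -> x < 1) -> rwo (gmonoid E).
Proof.
move=> rE E1.
have pw1 n g : gpow E n g -> g <= 1.
  elim: n g => [g ->//|n IH _ [a [b [Ea Eb ->]]]].
  by rewrite -[leRHS]mulg1; apply: oag_leM; [apply/ltW/E1 | apply: IH].
apply: seq_rwo => s /choice[l slP]; apply: contrapT => nobad.
pose P (u : nat -> nat * G) := (forall i, gpow E (u i).1 (u i).2) /\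
   (forall i j, (i < j)%N -> (u i).2 < (u j).2).
have [|m mlim|m [mE mbad] mmin] := @min_bad_seq _ fst P (fun n => (l n, s n)).
- split=> [i|i j ij] /=; first exact: slP.
  by rewrite ltNge; apply/negP => le; apply: nobad; exists i, j.
- split=> [i|i j ij].
    by have [u [uE _] <-] := mlim i.+1.
  have [u [_ ub] uP] := mlim j.+1.
  by rewrite -!uP ?ub // ltnS ltnW.
have /choice[e /choice[v /choice[q evP]]] : forall n, exists e v q,
    [/\ E e, gpow E q v, (m n).1 = q.+1 & (m n).2 = e * v].
  move=> n; have := mE n; have := mbad n n.+1 (ltnSn n).
  case: (m n) => [[|q] g] /=.
    by move=> + g1; rewrite g1 ltNge (pw1 _ _ (mE n.+1)).
  by move=> _ [a [b [? ? ->]]]; exists a, b, q.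
have [n|h [hlt hle]] := @rwo_seq E e rE; first by case: (evP n).
have hge i : (h 0%N <= h i)%N by case: i => // i; apply/ltnW/hlt.
pose t i := if (i < h 0%N)%N then m i else (q (h (i - h 0%N)), v (h (i - h 0%N)))%N.
have tE i : gpow E (t i).1 (t i).2.
  by rewrite /t; case: ifP => // _; case: (evP (h (i - h 0%N)%N)).
have vm n : (m n).2 <= v n.
  have [Ee _ _ ->] := evP n; rewrite -[leRHS]mul1g; apply: oag_leM => //.
  exact/ltW/E1.
have tbad i j : (i < j)%N -> (t i).2 < (t j).2.
  move=> ij; rewrite /t; case: ltnP => ih; case: ltnP => jh //=.
  - exact: mbad.
  - by apply: lt_le_trans (vm _); apply: mbad; apply: leq_trans (hge _).
  - by have := leq_ltn_trans ih (ltn_trans ij jh); rewrite ltnn.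
  - rewrite ltNge; apply/negP => le.
    have lt : (h (i - h 0) < h (j - h 0))%N.
      by apply: hlt; rewrite ltn_sub2r // (leq_ltn_trans ih).
    have := mbad _ _ lt; have [_ _ _ ->] := evP (h (i - h 0))%N.
    have [_ _ _ ->] := evP (h (j - h 0))%N; rewrite ltNge oag_leM //.
    by apply: hle; rewrite leq_sub2r // ltnW.
have := mmin (h 0%N) t (conj tE tbad); rewrite /t ltnn subnn /=.
have [_ _ -> _] := evP (h 0%N); rewrite ltnn => abs.
by have : false by apply: abs => i ->.
Qed.

Lemma gpow_fin E g : rwo E -> (forall x, E x -> x < 1) ->
  exists N, forall n, (N <= n)%N -> ~ gpow E n g.
Proof.
move=> rE E1; apply: contrapT => ninf.
pose B := [set g | forall N, exists2 n, (N <= n)%N & gpow E n g].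
have Bg : B g.
  move=> N; apply: contrapT => nn; apply: ninf; exists N => n Nn Eg.
  by apply: nn; exists n.
have rM := rwo_gmonoid rE E1.
have [||m Bm mP] := rM B; [by move=> x /(_ 0%N)[n _ ?]; exists n| by exists g|].
have /choice[e /choice[v /choice[q evP]]] : forall n, exists e v q,
    [/\ E e, gpow E q v, (n <= q)%N & m = e * v].
  move=> n; have [[//|k] nk [a [b [Ea Eb mE]]]] := Bm n.+1.
  by exists a, b, k.
have [n|h [hlt hle]] := @rwo_seq E e rE; first by case: (evP n).
have [n|h' [h'lt h'le]] := @rwo_seq _ (v \o h) rM.
  by exists (q (h n)); case: (evP (h n)).
have vE n : v n = m * (e n)^-1.
  by have [_ _ _ ->] := evP n; rewrite oag_mulC mulKg.
have vcst n : v (h (h' n)) = v (h (h' 0%N)).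
  apply: le_anti; rewrite (h'le 0%N n) //= !vE oag_leM2l oag_leV.
  by apply: hle; case: n => // n; apply/ltnW/h'lt.
have gen (f : nat -> nat) : {homo f : i j / (i < j)%N} -> forall n, (n <= f n)%N.
  by move=> fh; elim=> // n /leq_ltn_trans; apply; apply: fh.
have Bv : B (v (h (h' 0%N))).
  move=> N; exists (q (h (h' N))); last by rewrite -(vcst N); case: (evP (h (h' N))).
  have [_ _ + _] := evP (h (h' N)); apply: leq_trans.
  by apply: leq_trans (gen h' h'lt N) (gen h hlt _).
have [Ee _ _ mE] := evP (h (h' 0%N)).
have := mP _ Bv; rewrite leNgt {1}mE -[X in _ < X]mul1g ![_ * v _]oag_mulC.
by rewrite oag_ltM2l // E1.
Qed.

End ReverseWellOrdered.

(* An infinite cardinal is the well-ordered type of an initial ordinal (an      *)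
(* ordinal equinumerous to none of its elements); it is regular when none of   *)
(* its cofinal subsets has a smaller cardinality.                               *)
Record regular_uncountable_cardinal (d : Order.disp_t) (kappa : orderType d) :
    Prop := RegularUncountableCardinal {
  ruc_well_ordered : forall A : set kappa, A !=set0 ->
    exists2 m, A m & forall x, A x -> (m <= x)%O;
  ruc_initial : forall a : kappa,
    ~ ([set: kappa] #<= [set x | (x < a)%O])%card;
  ruc_uncountable : ~ countable [set: kappa];
  ruc_regular : forall A : set kappa,
    (forall a, exists2 x, A x & (a <= x)%O) -> ([set: kappa] #<= A)%card
}.

(* A, with the reverse of the order of G, is isomorphic to the ordinal          *)
(* {w | w < a} for some a < kappa.                                              *)
Definition reverse_order_type_lt (d d' : Order.disp_t) (G : orderType d)
    (kappa : orderType d') (A : set G) : Prop :=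
  exists (a : kappa) (f : G -> kappa), set_bij A [set w | (w < a)%O] f /\
    (forall x y, A x -> A y -> (y < x)%O -> (f x < f y)%O).

Lemma card_le_inj_image T U (A : set T) (f : T -> U) :
  {in A &, injective f} -> (A #<= f @` A)%card.
Proof. by move=> /inj_card_eq; rewrite card_eq_le => /andP[]. Qed.

Section Small.
Context (d' : Order.disp_t) (kappa : orderType d').
Hypothesis kreg : regular_uncountable_cardinal kappa.
Local Open Scope order_scope.

Definition small T (A : set T) : Prop := ~ ([set: kappa] #<= A)%card.

Lemma small_sub T (A B : set T) : A `<=` B -> small B -> small A.
Proof. by move=> AB sB lA; apply: sB; apply: card_le_trans lA (subset_card_le AB). Qed.

Lemma small_countable T (A : set T) : countable A -> small A.
Proof. by move=> cA lA; apply: (ruc_uncountable kreg); apply: card_le_trans lA cA. Qed.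

Lemma kappa_inhabited : exists a : kappa, True.
Proof.
apply: contrapT => /forallNP na; apply: (@small_countable kappa set0) => //.
by apply: subset_card_le => x _; case: (na x).
Qed.

Lemma small_bounded T (A : set T) (f : T -> kappa) : small A ->
  exists b, forall x, A x -> f x < b.
Proof.
move=> sA; apply: contrapT => /forallNP nb.
have : ([set: kappa] #<= f @` A)%card.
  apply: (ruc_regular kreg) => a; apply: contrapT => na; apply: (nb a) => x Ax.
  by rewrite ltNge; apply/negP => ax; apply: na; exists (f x) => //; exists x.
by move=> le; apply: sA; apply: card_le_trans le (card_image_le _ _).
Qed.

Lemma small_bigcup J T (D : set J) (F : J -> set T) : small D ->
  (forall i, D i -> small (F i)) -> small (\bigcup_(i in D) F i).
Proof.
move=> sD sF leU.
have [w0 _] := kappa_inhabited.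
have [t0 _] : exists t : T, True.
  apply: contrapT => /forallNP nt.
  have /small_countable : countable (\bigcup_(i in D) F i).
    suff -> : \bigcup_(i in D) F i = set0 by [].
    by rewrite -subset0 => t; case: (nt t).
  by [].
have [g gU ginj] := card_le_fun t0 leU.
have /choice[i iP] : forall w, exists i, D i /\ F i (g w).
  by move=> w; have [i Di Fi] := gU w I; exists i.
have /choice[b bP] : forall j, exists b, D j -> forall w, i w = j -> w < b.
  move=> j; have [Dj|] := pselect (D j); last by exists w0.
  have /(small_bounded id)[b bP] : small [set w | i w = j].
    move=> le; apply: (sF j Dj); apply: card_le_trans le _.
    have /card_le_trans : ([set w | i w = j] #<= g @` [set w | i w = j])%card.
      by apply: card_le_inj_image => x y _ _; apply: ginj.
    apply; apply: subset_card_le => _ [w /= <- <-]; by case: (iP w).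
  by exists b => _ w /bP.
have [B BP] := small_bounded b sD.
have := BP _ (iP B).1; rewrite ltNge => /negP; apply.
by apply/ltW/bP => //; case: (iP B).
Qed.

Lemma small_setU T (A B : set T) : small A -> small B -> small (A `|` B).
Proof.
move=> sA sB; rewrite (_ : setU A B = \bigcup_(b in [set: bool]) if b then A else B).
  by apply: small_bigcup => [|[]] //; apply: small_countable; apply: countableP.
apply/seteqP; split=> x /=; first by case=> ?; [exists true|exists false].
by case=> -[] _; [left|right].
Qed.

Lemma small_image T U (f : T -> U) (A : set T) : small A -> small (f @` A).
Proof. by move=> sA le; apply: sA; apply: card_le_trans le (card_image_le _ _). Qed.

Lemma reverse_order_type_ltP (d : Order.disp_t) (G : orderType d) (A : set G) :
  reverse_well_ordered A -> reverse_order_type_lt kappa A <-> small A.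
Proof.
move=> rA; split=> [[a [f [[fS fI fJ] _]]] le|sA].
  apply: (ruc_initial kreg (a := a)); apply: card_le_trans le _.
  have /card_le_trans : (A #<= f @` A)%card.
    exact: card_le_inj_image.
  by apply; apply: subset_card_le => _ [x Ax <-]; apply: fS.
have [w0 _] := kappa_inhabited.
have /choice[mn mnP] : forall S : set kappa, exists m, S !=set0 ->
    S m /\ forall x, S x -> m <= x.
  move=> S; have [/(ruc_well_ordered kreg)[m Sm mP]|] := pselect (S !=set0).
    by exists m.
  by exists w0.
pose R y x := [/\ A x, A y & x < y].
have Rwf : well_founded R.
  move=> x; apply: contrapT => nx.
  have [||m [Am nm] mP] := rA [set z | A z /\ ~ Acc R z].
  - by move=> z [].
  - exists x; split=> //; apply: contrapT => nAx; apply: nx.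
    by constructor=> y [].
  - apply: nm; constructor=> y [_ Ay my]; apply: contrapT => ny.
    by have := mP y (conj Ay ny); rewrite leNgt my.
pose F x (rec : forall y, R y x -> kappa) : kappa :=
  mn [set w | forall y (Ry : R y x), rec y Ry < w].
pose f := Fix Rwf (fun=> kappa) F.
have fE x : f x = mn [set w | forall y, R y x -> f y < w].
  rewrite /f Fix_eq // => z g h gh; congr mn; apply/seteqP; split=> w /= H y Ry.
    by rewrite -gh.
  by rewrite gh.
have ub x : [set w | forall y, R y x -> f y < w] !=set0.
  have [b bP] := small_bounded f sA.
  by exists b => y [_ Ay _]; apply: bP.
have fP x : (forall y, R y x -> f y < f x) /\
    forall w, (forall y, R y x -> f y < w) -> f x <= w.
  by rewrite fE; apply: mnP; apply: ub.
have ini x : A x -> forall w, w < f x -> exists2 y, A y & f y = w.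
  elim: (Rwf x) => {}x _ IH Ax w wfx.
  have [y Rxy wy] : exists2 y, R y x & w <= f y.
    apply: contrapT => ny; have := (fP x).2 w; rewrite leNgt wfx => /(_ _)H.
    suff: false by []; apply: H => y Ryx.
    by rewrite ltNge; apply/negP => wy; apply: ny; exists y.
  have [_ Ay _] := Rxy.
  by move: wy; rewrite le_eqVlt => /orP[/eqP->|/IH]; [exists y|apply].
have fmono x y : A x -> A y -> y < x -> f x < f y.
  by move=> Ax Ay yx; apply: (fP y).1.
have [b0 b0P] := small_bounded f sA.
have [aP amin] : (forall x, A x -> f x < mn [set w | forall x, A x -> f x < w]) /\
    (forall w, (forall x, A x -> f x < w) -> mn [set w | forall x, A x -> f x < w] <= w).
  by apply: mnP; exists b0.
exists (mn [set w | forall x, A x -> f x < w]), f; split=> //; split.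
- by move=> x Ax; apply: aP.
- move=> x y /set_mem Ax /set_mem Ay fxy.
  case: (ltgtP x y) => // xy; [have := fmono _ _ Ay Ax xy|have := fmono _ _ Ax Ay xy];
    by rewrite fxy ltxx.
- move=> w /= wa.
  have [y Ay wy] : exists2 y, A y & w <= f y.
    apply: contrapT => ny; move: wa; rewrite ltNge => /negP; apply.
    by apply: amin => y Ay; rewrite ltNge; apply/negP => wy; apply: ny; exists y.
  move: wy; rewrite le_eqVlt => /orP[/eqP->|/(ini y Ay)[z Az <-]].
    by exists y.
  by exists z.
Qed.

End Small.

Definition support_set (k : realFieldType) (G : Type) (f : G -> k) : set G :=
  [set g | f g != 0].

Definition hahn_support (k : realFieldType) (d d' : Order.disp_t)
    (G : orderType d) (kappa : orderType d') (f : G -> k) : bool :=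
  `[< reverse_well_ordered (support_set f) /\
      reverse_order_type_lt kappa (support_set f) >].

(* The carrier of k((G))_kappa; x g is the coefficient of g in x. *)
Record hahn (k : realFieldType) (d : Order.disp_t)
    (G : orderedAbelianGroupType d) (d' : Order.disp_t) (kappa : orderType d')
    (kappa_reg : regular_uncountable_cardinal kappa) := Hahn {
  coef :> G -> k;
  coef_subproof : hahn_support kappa coef
}.
Arguments hahn k {d} G {d' kappa} kappa_reg.

Section HahnField.
Context (k : realFieldType) (d : Order.disp_t) (G : orderedAbelianGroupType d).
Context (d' : Order.disp_t) (kappa : orderType d').
Context (kreg : regular_uncountable_cardinal kappa).
Local Notation K := (hahn k G kreg).
Local Notation rwo := (@reverse_well_ordered d G).
Local Notation smallG := (@small d' kappa G).
Implicit Types (x y z : K) (g h : G) (r : k).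

HB.instance Definition _ := [isSub for @coef k d G d' kappa kreg].
HB.instance Definition _ := [Choice of K by <:].

Lemma hahnP x y : (forall g, x g = y g) <-> x = y.
Proof. by split=> [e|->//]; apply: val_inj; apply/funext. Qed.

Lemma supp_rwo x : rwo (support_set x).
Proof. by have /asboolP[] := coef_subproof x. Qed.

Lemma supp_small x : smallG (support_set x).
Proof.
by have /asboolP[rx /(reverse_order_type_ltP kreg rx)] := coef_subproof x.
Qed.

Arguments supp_rwo : clear implicits.
Arguments supp_small : clear implicits.

Lemma mkhahn_subproof (f : G -> k) (A : set G) : rwo A -> smallG A ->
  (forall g, f g != 0 -> A g) ->
  hahn_support kappa f.
Proof.
move=> rA sA fA; have rf : rwo (support_set f) by apply: rwo_sub rA.
by apply/asboolP; split=> //; apply/(reverse_order_type_ltP kreg) => //; apply: small_sub sA.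
Qed.

Lemma hahn_term_subproof g r :
  hahn_support kappa (fun h => if h == g then r else 0).
Proof.
apply: (@mkhahn_subproof _ [set g]) => [B Bg [x Bx]||h /=].
- by exists x => // y By; rewrite (Bg y By) (Bg x Bx).
- by apply: small_countable kreg _ _ _; apply: countable1.
- by case: (eqVneq h g) => [->|_] //; rewrite eqxx.
Qed.
(* the one-term series g r *)
Definition hahn_term g r : K := Hahn kreg (hahn_term_subproof g r).

Definition monomial g : K := hahn_term g 1.
Definition hahn_const r : K := hahn_term 1%g r.

Lemma hahn_zero_subproof :
  hahn_support kappa (fun _ : G => 0 : k).
Proof.
apply: (@mkhahn_subproof _ set0) => [B B0 [x /B0//]||h /=].
- by apply: small_countable kreg _ _ _; apply: countable0.
- by rewrite eqxx.
Qed.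
Definition hahn_zero : K := Hahn kreg hahn_zero_subproof.

Lemma hahn_opp_subproof x :
  hahn_support kappa (fun g => - x g).
Proof.
apply: (@mkhahn_subproof (fun g => - x g) _ (supp_rwo x) (supp_small x)) => g /=.
by rewrite oppr_eq0.
Qed.
Definition hahn_opp x : K := Hahn kreg (hahn_opp_subproof x).

Lemma hahn_add_subproof x y :
  hahn_support kappa (fun g => x g + y g).
Proof.
apply: (@mkhahn_subproof (fun g => x g + y g) _ (rwo_setU (supp_rwo x) (supp_rwo y))
  (small_setU kreg (supp_small x) (supp_small y))) => g /=.
apply: contraNP => /not_orP[/negP nx /negP ny].
by move: nx ny; rewrite !negbK => /eqP-> /eqP->; rewrite addr0.
Qed.
Definition hahn_add x y : K := Hahn kreg (hahn_add_subproof x y).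

Fact hahn_addA : associative hahn_add.
Proof. by move=> x y z; apply/hahnP => g /=; rewrite addrA. Qed.
Fact hahn_addC : commutative hahn_add.
Proof. by move=> x y; apply/hahnP => g /=; rewrite addrC. Qed.
Fact hahn_add0 : left_id hahn_zero hahn_add.
Proof. by move=> x; apply/hahnP => g /=; rewrite add0r. Qed.
Fact hahn_addN : left_inverse hahn_zero hahn_opp hahn_add.
Proof. by move=> x; apply/hahnP => g /=; rewrite addNr. Qed.

HB.instance Definition _ :=
  GRing.isZmodule.Build K hahn_addA hahn_addC hahn_add0 hahn_addN.

Lemma hahn_coefD x y g : (x + y) g = x g + y g. Proof. by []. Qed.
Lemma hahn_coefN x g : (- x) g = - x g. Proof. by []. Qed.
Lemma hahn_coef0 g : (0 : K) g = 0. Proof. by []. Qed.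
Lemma hahn_coefB x y g : (x - y) g = x g - y g. Proof. by []. Qed.
Lemma hahn_coef_sum (I : Type) (s : seq I) (P : pred I) (F : I -> K) g :
  (\sum_(i <- s | P i) F i) g = \sum_(i <- s | P i) F i g.
Proof. exact: (big_morph (fun x : K => x g) (fun x y => hahn_coefD x y g) (hahn_coef0 g)). Qed.

(* The sum over all a, b in G with a b = g; only finitely many of its terms are *)
(* nonzero.                                                                     *)
Definition cauchy_product (x y : G -> k) (g : G) : k :=
  \sum_(a \in [set: G]) x a * y (a^-1 * g)%g.

Lemma cauchy_productE (x y : G -> k) g (s : seq G) : uniq s ->
  (forall a, x a != 0 -> y (a^-1 * g)%g != 0 -> a \in s) ->
  cauchy_product x y g = \sum_(a <- s) x a * y (a^-1 * g)%g.
Proof.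
move=> us sP; rewrite /cauchy_product (fsbig_seq _ _ us); symmetry.
apply: fsbig_widen => // a /= [_ na]; apply/eqP/negPn/negP.
by rewrite mulf_eq0 negb_or => /andP[xa ya]; apply: na; apply: sP.
Qed.

Lemma fiber_seq (A B : set G) g : rwo A -> rwo B ->
  exists2 s : seq G, uniq s & forall a, A a -> B (a^-1 * g)%g -> a \in s.
Proof.
move=> rA rB; have /finite_seqP[s sE] := rwo_fiber g rA rB.
exists (undup s) => [|a Aa Ba]; first exact: undup_uniq.
by have : [set a | A a /\ B (a^-1 * g)%g] a by []; rewrite sE mem_undup.
Qed.

Lemma gprod_small (A B : set G) : smallG A -> smallG B -> smallG (gprod A B).
Proof.
move=> sA sB.
have : smallG (\bigcup_(a in A) ((fun b => a * b)%g @` B)).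
  by apply: small_bigcup => // a _; apply: small_image.
by apply: small_sub => _ [a [b [Aa Bb ->]]]; exists a => //; exists b.
Qed.

Lemma cauchy_product_supp (x y : G -> k) g : cauchy_product x y g != 0 ->
  exists a, x a != 0 /\ y (a^-1 * g)%g != 0.
Proof.
apply: contraNP => /forallNP na; rewrite /cauchy_product fsbig1 // => a _.
apply/eqP; rewrite mulf_eq0 -[_ || _]negbK negb_or; apply/negP => /andP[xa ya].
by apply: (na a).
Qed.

Lemma cauchy_product_gprod (x y : G -> k) g : cauchy_product x y g != 0 ->
  gprod (support_set x) (support_set y) g.
Proof.
move=> /cauchy_product_supp[a [xa ya]].
by exists a, (a^-1 * g)%g; split=> //; rewrite mulVKg.
Qed.

Lemma hahn_mul_subproof x y :
  hahn_support kappa (cauchy_product x y).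
Proof.
apply: (@mkhahn_subproof (cauchy_product x y) _ (rwo_gprod (supp_rwo x) (supp_rwo y))
  (gprod_small (supp_small x) (supp_small y))) => g.
exact: cauchy_product_gprod.
Qed.
Definition hahn_mul x y : K := Hahn kreg (hahn_mul_subproof x y).

Lemma oag_divK a g : ((a^-1 * g)^-1 * g)%g = a.
Proof. by rewrite invgM invgK oag_mulC mulVKg. Qed.

Fact hahn_mulC : commutative hahn_mul.
Proof.
move=> x y; apply/hahnP => g /=.
have [s us sP] := fiber_seq g (supp_rwo x) (supp_rwo y).
rewrite (cauchy_productE us sP) (@cauchy_productE y x g [seq (a^-1 * g)%g | a <- s]).
- by rewrite big_map; apply: eq_bigr => a _; rewrite mulrC oag_divK.
- by rewrite map_inj_uniq // => a b /mulIg /invg_inj.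
- move=> a ya xa; apply/mapP; exists (a^-1 * g)%g.
    by apply: sP => //; rewrite oag_divK.
  by rewrite oag_divK.
Qed.

Fact hahn_mulA : associative hahn_mul.
Proof.
move=> x y z; apply/hahnP => g; apply/esym => /=.
have [A uA AP] := fiber_seq g (rwo_gprod (supp_rwo x) (supp_rwo y)) (supp_rwo z).
have [B uB BP] : exists2 B : seq G, uniq B &
    forall b a, a \in A -> x b != 0 -> y (b^-1 * a)%g != 0 -> b \in B.
  have /choice[s sP] : forall a, exists s : seq G,
      forall b, x b != 0 -> y (b^-1 * a)%g != 0 -> b \in s.
    by move=> a; have [s _ sP] := fiber_seq a (supp_rwo x) (supp_rwo y); exists s.
  exists (undup (flatten [seq s a | a <- A])); first exact: undup_uniq.
  move=> b a aA xb yb; rewrite mem_undup; apply/flatten_mapP; exists a => //.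
  exact: sP.
rewrite (@cauchy_productE _ z g A) //; last first.
  by move=> a xya za; apply: AP => //; apply: cauchy_product_gprod.
under eq_big_seq => a aA.
  rewrite (@cauchy_productE x y a B) //; last by move=> b; apply: BP.
  rewrite mulr_suml; over.
rewrite exchange_big /= (@cauchy_productE x _ g B) //; last first.
  move=> b xb /cauchy_product_supp[c [yc zc]].
  have bcA : (b * c)%g \in A.
    apply: AP; first by exists b, c.
    by rewrite invgM -mulgA.
  by apply: (BP b _ bcA) => //; rewrite mulKg.
apply: eq_bigr => b _; have [->|xb] := eqVneq (x b) 0.
  by rewrite mul0r big1 // => a _; rewrite !mul0r.
rewrite (@cauchy_productE y z _ [seq (b^-1 * a)%g | a <- A]).
- rewrite big_map mulr_sumr; apply: eq_bigr => a _.
  by rewrite -mulrA; congr (_ * (_ * z _)); rewrite invgM invgK -mulgA mulVKg.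
- by rewrite map_inj_uniq // => a a' /mulgI.
- move=> c yc zc; apply/mapP; exists (b * c)%g; last by rewrite mulKg.
  apply: AP; first by exists b, c.
  by rewrite /support_set /= invgM -mulgA.
Qed.

Lemma hahn_term_mul g r x h : cauchy_product (hahn_term g r) x h = r * x (g^-1 * h)%g.
Proof.
rewrite (@cauchy_productE _ x h [:: g]) //; first by rewrite big_seq1 /= eqxx.
by move=> a /=; rewrite inE; case: (eqVneq a g) => //; rewrite eqxx.
Qed.

Definition hahn_one : K := hahn_const 1.

Fact hahn_mul1 : left_id hahn_one hahn_mul.
Proof.
by move=> x; apply/hahnP => g /=; rewrite hahn_term_mul mul1r invg1 mul1g.
Qed.

Fact hahn_mulDl : left_distributive hahn_mul +%R.
Proof.
move=> x y z; apply/hahnP => g /=; rewrite -/(x + y).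
have [s us sP] := fiber_seq g (rwo_setU (supp_rwo x) (supp_rwo y)) (supp_rwo z).
rewrite !(@cauchy_productE _ z g s) //.
- by rewrite -big_split /=; apply: eq_bigr => a _; rewrite mulrDl.
- by move=> a ya za; apply: sP => //; right.
- by move=> a ya za; apply: sP => //; left.
- move=> a xya za; apply: sP => //; apply: contraNP xya => /not_orP[/negP nx /negP ny].
  by move: nx ny; rewrite !negbK => /eqP x0 /eqP y0; rewrite /= x0 y0 addr0.
Qed.

Fact hahn_one_neq0 : hahn_one != 0.
Proof.
by apply/eqP => /hahnP/(_ 1%g)/eqP; rewrite /= eqxx oner_eq0.
Qed.

HB.instance Definition _ := GRing.Zmodule_isComNzRing.Build K
  hahn_mulA hahn_mulC hahn_mul1 hahn_mulDl hahn_one_neq0.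

Lemma hahn_coefM x y g : (x * y) g = cauchy_product x y g. Proof. by []. Qed.
Lemma hahn_coef1 g : (1 : K) g = if g == 1%g then 1 else 0. Proof. by []. Qed.

Lemma gpow_coef x n g : (x ^+ n) g != 0 -> gpow (support_set x) n g.
Proof.
elim: n g => [g|n IH g].
  by rewrite expr0 hahn_coef1; case: (eqVneq g 1%g) => // _; rewrite eqxx.
rewrite exprS hahn_coefM => /cauchy_product_gprod[a [b [xa xb ->]]].
by exists a, b; split=> //; apply: IH.
Qed.

Lemma gpow_small (E : set G) n : smallG E -> smallG (gpow E n).
Proof.
move=> sE; elim: n => [|n IH] /=; last exact: gprod_small.
by apply: small_countable kreg _ _ _; apply: countable1.
Qed.

Lemma gmonoid_small (E : set G) : smallG E -> smallG (gmonoid E).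
Proof.
move=> sE; have : smallG (\bigcup_(n in [set: nat]) gpow E n).
  apply: small_bigcup => // [|n _]; last exact: gpow_small.
  by apply: small_countable kreg _ _ _; apply: countableP.
by apply: small_sub => g [n ng]; exists n.
Qed.

Lemma inv_1_sub (e : K) : (forall g, e g != 0 -> (g < 1%g)%O) ->
  exists y, y * (1 - e) = 1.
Proof.
move=> e1.
have /choice[N NP] : forall g, exists N, forall n, (N <= n)%N -> ~ gpow (support_set e) n g.
  by move=> g; apply: gpow_fin (supp_rwo e) e1.
pose f g := \sum_(n < N g) (e ^+ n) g.
have fE g m : (N g <= m)%N -> f g = (\sum_(n < m) e ^+ n) g.
  move=> Nm; rewrite hahn_coef_sum /f -!(big_mkord predT (fun n => (e ^+ n) g)).
  rewrite [RHS](big_cat_nat (leq0n _) Nm) /=.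
  rewrite [X in _ = _ + X]big1_seq ?addr0 // => n /=.
  rewrite mem_index_iota => /andP[Nn _]; apply/eqP/negPn/negP => /gpow_coef.
  exact: NP.
have fP : hahn_support kappa f.
  apply: (@mkhahn_subproof _ _ (rwo_gmonoid (supp_rwo e) e1)
    (gmonoid_small (supp_small e))).
  move=> g fg; apply: contrapT => ng; move/negP: fg; apply; apply/eqP.
  rewrite /f big1 // => n _; apply/eqP/negPn/negP => /gpow_coef ?.
  by apply: ng; exists n.
pose y : K := Hahn kreg fP.
exists y; rewrite mulrC; apply/hahnP => g.
have [s us sP] := fiber_seq g (supp_rwo (1 - e)) (rwo_gmonoid (supp_rwo e) e1).
pose m := (N g + \max_(a <- s) N (a^-1 * g)%g)%N.
have -> : ((1 - e) * y) g = ((1 - e) * \sum_(n < m) e ^+ n) g.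
  rewrite !hahn_coefM !(@cauchy_productE (1 - e) _ g s) //.
  - apply: eq_big_seq => a sa; congr (_ * _); apply: fE.
    by apply: leq_trans (leq_addl _ _); apply: leq_bigmax_seq.
  - move=> a ea; rewrite hahn_coef_sum => nz; apply: sP => //.
    apply: contrapT => nM; move/negP: nz; apply; apply/eqP.
    by rewrite big1 // => n _; apply/eqP/negPn/negP => /gpow_coef ?; apply: nM; exists n.
  - move=> a ea nz; apply: sP => //.
    apply: contrapT => nM; move/negP: nz; apply; apply/eqP.
    by rewrite /= /f big1 // => n _; apply/eqP/negPn/negP => /gpow_coef ?; apply: nM; exists n.
rewrite -opprB mulNr -subrX1 opprB hahn_coefB.
have -> : (e ^+ m) g = 0; last by rewrite subr0.
by apply/eqP/negPn/negP => /gpow_coef; apply: NP; apply: leq_addr.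
Qed.

Lemma hahn_lead x : x != 0 ->
  exists2 g, x g != 0 & forall h, (g < h)%O -> x h = 0.
Proof.
move=> x0; have [//||g xg gP] := @supp_rwo x (support_set x).
  apply: contrapT => /forallNP nx; move/negP: x0; apply; apply/eqP/hahnP => g.
  by apply/eqP/negPn/negP/nx.
exists g => // h gh; apply/eqP/negPn/negP => xh.
by have := gP h xh; rewrite leNgt gh.
Qed.

Lemma hahn_term_mulE g r x h : (hahn_term g r * x) h = r * x (g^-1 * h)%g.
Proof. exact: hahn_term_mul. Qed.

Lemma hahn_unit x : x != 0 -> exists y, y * x = 1.
Proof.
move=> x0; have [g xg gP] := hahn_lead x0.
pose u := hahn_term g^-1%g (x g)^-1.
have [|y yP] := @inv_1_sub (1 - u * x).
  move=> h; rewrite hahn_coefB hahn_coef1 hahn_term_mulE invgK.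
  case: (ltgtP h 1%g) => //= [h1|->].
    have xgh : x (g * h)%g = 0.
      by apply: gP; rewrite -[X in (X < _)%O]mulg1 oag_ltM2l.
    by rewrite xgh mulr0 subr0 eqxx.
  by rewrite mulg1 mulVf // subrr eqxx.
by exists (y * u); rewrite -mulrA -[u * x](subKr 1).
Qed.

Definition hahn_inv x : K := xget 0 [set y | y * x = 1].

Fact hahn_mulVx x : x != 0 -> hahn_inv x * x = 1.
Proof. by move=> /hahn_unit[y yx]; apply: (@xgetPex _ 0 [set y | y * x = 1]); exists y. Qed.

Fact hahn_inv0 : hahn_inv 0 = 0.
Proof.
by apply: xgetPN => y /=; rewrite mulr0 => /esym/eqP; rewrite oner_eq0.
Qed.

HB.instance Definition _ := GRing.ComNzRing_isField.Build K hahn_mulVx hahn_inv0.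

(* the coefficient of the largest element of the support is positive *)
Definition hahn_positive x : Prop :=
  exists g, 0 < x g /\ forall h, (g < h)%O -> x h = 0.
Definition hahn_lt x y : bool := `[< hahn_positive (y - x) >].
Definition hahn_le x y : bool := (x == y) || hahn_lt x y.
Definition hahn_norm x : K := if hahn_le 0 x then x else - x.

Lemma hahn_lt0P x : reflect (hahn_positive x) (hahn_lt 0 x).
Proof. by rewrite /hahn_lt subr0; apply: asboolP. Qed.

Fact hahn_lt0_add x y : hahn_lt 0 x -> hahn_lt 0 y -> hahn_lt 0 (x + y).
Proof.
move=> /hahn_lt0P[g [xg gP]] /hahn_lt0P[h [yh hP]]; apply/hahn_lt0P.
case: (ltgtP g h) => gh.
- exists h; split=> [|j hj]; rewrite hahn_coefD; first by rewrite gP // add0r.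
  by rewrite gP ?hP ?addr0 // (lt_trans gh).
- exists g; split=> [|j hj]; rewrite hahn_coefD; first by rewrite hP // addr0.
  by rewrite gP ?hP ?addr0 // (lt_trans gh).
- rewrite -gh in yh hP; exists g; split=> [|j gj]; rewrite hahn_coefD.
    exact: addr_gt0.
  by rewrite gP ?hP ?addr0.
Qed.

Fact hahn_lt0_mul x y : hahn_lt 0 x -> hahn_lt 0 y -> hahn_lt 0 (x * y).
Proof.
move=> /hahn_lt0P[g [xg gP]] /hahn_lt0P[h [yh hP]]; apply/hahn_lt0P.
have leg a : x a != 0 -> (a <= g)%O by rewrite leNgt; apply: contra => /gP->.
have leh b : y b != 0 -> (b <= h)%O by rewrite leNgt; apply: contra => /hP->.
exists (g * h)%g; split=> [|j gj]; rewrite hahn_coefM.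
  rewrite (@cauchy_productE x y _ [:: g]) //; first by rewrite big_seq1 mulKg mulr_gt0.
  move=> a xa ya; rewrite inE; apply/eqP/le_anti; rewrite leg //=.
  have := leh _ ya; rewrite -(oag_leM2l a) mulVKg ![(_ * h)%g]oag_mulC.
  by rewrite oag_leM2l.
apply/eqP/negPn/negP => /cauchy_product_gprod[a [b [xa yb jE]]].
by move: gj; rewrite ltNge jE oag_leM ?leg ?leh.
Qed.

Fact hahn_sub_gt0 x y : hahn_lt 0 (y - x) = hahn_lt x y.
Proof. by rewrite /hahn_lt subr0. Qed.

Fact hahn_lt0_ngt0 x : hahn_lt 0 x -> ~~ hahn_lt x 0.
Proof.
move=> /hahn_lt0P[g [xg gP]]; apply/negP; rewrite -hahn_sub_gt0 sub0r.
move=> /hahn_lt0P[h []]; rewrite hahn_coefN oppr_gt0 => xh hP.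
have := hP g; case: (ltgtP g h) => gh.
- by rewrite gP ?ltxx in xh.
- by move=> /(_ isT)/eqP; rewrite hahn_coefN oppr_eq0 => /eqP x0; rewrite x0 ltxx in xg.
- by rewrite -gh in xh; have := lt_trans xg xh; rewrite ltxx.
Qed.

Fact hahn_lt0_total x : x != 0 -> hahn_lt 0 x || hahn_lt x 0.
Proof.
move=> /hahn_lead[g xg gP]; case: (ltgtP (x g) 0) xg => // xg _; apply/orP.
  right; rewrite -hahn_sub_gt0 sub0r; apply/hahn_lt0P; exists g.
  by rewrite hahn_coefN oppr_gt0; split=> // h /gP xh; rewrite hahn_coefN xh oppr0.
by left; apply/hahn_lt0P; exists g.
Qed.

Fact hahn_normN x : hahn_norm (- x) = hahn_norm x.
Proof.
rewrite /hahn_norm /hahn_le opprK ![0 == _]eq_sym oppr_eq0.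
have [->|x0] /= := eqVneq x 0; first by rewrite oppr0.
have -> : hahn_lt 0 (- x) = hahn_lt x 0 by rewrite -[RHS]hahn_sub_gt0 sub0r.
have := hahn_lt0_total x0; have := @hahn_lt0_ngt0 x.
by case: (hahn_lt 0 x) => [/(_ isT)/negPf->//|_ /= ->].
Qed.

Fact hahn_ge0_norm x : hahn_le 0 x -> hahn_norm x = x.
Proof. by rewrite /hahn_norm => ->. Qed.

Fact hahn_le_def x y : hahn_le x y = (x == y) || hahn_lt x y.
Proof. by []. Qed.

HB.instance Definition _ := Num.IntegralDomain_isLtReal.Build K
  hahn_lt0_add hahn_lt0_mul hahn_lt0_ngt0 hahn_sub_gt0 hahn_lt0_total
  hahn_normN hahn_ge0_norm hahn_le_def.

End HahnField.

Arguments hahn_term {k d G d' kappa kreg} g r.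
Arguments monomial {k d G d' kappa kreg} g.
Arguments hahn_const {k d G d' kappa kreg} r.

Section OmegaField.
Variable K : realFieldType.
Implicit Types (O M : set K) (x y : K).

Definition convex_valuation_ring O : Prop :=
  [/\ O 1,
      forall x y, O x -> O y -> O (x - y),
      forall x y, O x -> O y -> O (x * y),
      forall x, O x \/ O x^-1 &
      forall x y, 0 <= x -> x <= y -> O y -> O x].

Definition asymp O x y : Prop :=
  exists c, [/\ O c, `|x| <= c * `|y| & `|y| <= c * `|x|].

Definition group_of_monomials O M : Prop :=
  [/\ forall m, M m -> 0 < m,
      M 1,
      forall m n, M m -> M n -> M (m * n),
      forall m, M m -> M m^-1 &
      forall x, x != 0 -> exists! m, M m /\ asymp O x m].

Definition omega_map M (omega : K -> K) : Prop :=
  [/\ set_bij [set: K] M omega,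
      forall x y, omega (x + y) = omega x * omega y &
      forall x y, x < y -> omega x < omega y].

Definition omega_field O M : Prop :=
  [/\ Num.real_closed_axiom K, convex_valuation_ring O,
      group_of_monomials O M & exists omega, omega_map M omega].

End OmegaField.

(* logk is the inverse of the isomorphism expk; its values outside of the       *)
(* positive elements of k are irrelevant.                                       *)
Record exponential_field (k : rcfType) (expk logk : k -> k) : Prop :=
    ExponentialField {
  expk_add : forall a b, expk (a + b) = expk a * expk b;
  expk_lt : forall a b, a < b -> expk a < expk b;
  expk_gt0 : forall a, 0 < expk a;
  expkK : forall a, logk (expk a) = a;
  logkK : forall a, 0 < a -> expk (logk a) = a
}.

Section AnalyticLogarithm.
Context (k : realFieldType) (d : Order.disp_t) (G : orderedAbelianGroupType d).
Context (d' : Order.disp_t) (kappa : orderType d').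
Context (kreg : regular_uncountable_cardinal kappa).
Local Notation K := (hahn k G kreg).
Implicit Types x y e : K.

Definition hahn_valuation_ring : set K :=
  [set x | exists r : k, `|x| <= hahn_const r].

Definition hahn_monomials : set K := range monomial.

Definition hahn_omega_field : Prop :=
  omega_field hahn_valuation_ring hahn_monomials.

Definition hahn_prec x y : Prop :=
  forall c : k, 0 < c -> hahn_const c * `|x| < `|y|.

Definition purely_infinite : set K :=
  [set x | forall g, x g != 0 -> (1%g < g)%O].

(* The family u is summable, with sum s. *)
Definition hahn_sum (u : nat -> K) (s : K) : Prop :=
  [/\ reverse_well_ordered (\bigcup_n support_set (u n)),
      forall g, finite_set [set n | u n g != 0] &
      forall g, s g = \sum_(n \in [set: nat]) u n g].

(* log is a total function; its values outside of the positive elements of K   *)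
(* are irrelevant. The n-th term of the series of log (1 + e) below is the one  *)
(* of exponent n + 1.                                                           *)
Record analytic_logarithm (logk : k -> k) (log : K -> K) : Prop :=
    AnalyticLogarithm {
  log_mul : forall x y, 0 < x -> 0 < y -> log (x * y) = log x + log y;
  log_lt : forall x y, 0 < x -> x < y -> log x < log y;
  log_surj : forall y, exists2 x, 0 < x & log x = y;
  log_const : forall r : k, 0 < r -> log (hahn_const r) = hahn_const (logk r);
  log_analytic : forall e, hahn_prec e 1 ->
    hahn_sum (fun n => (-1) ^+ n.+2 * e ^+ n.+1 / n.+1%:R) (log (1 + e));
  log_monomials : log @` hahn_monomials = purely_infinite
}.

End AnalyticLogarithm.

Arguments hahn_omega_field k {d} G {d' kappa} kreg.

(* Main.v *)
From HB Require Import structures.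
Require Import Defs.
From mathcomp Require Import all_boot all_order all_algebra.
From mathcomp Require Import boolp classical_sets cardinality fsbigop.
From mathcomp Require Import ring reals sequences exp.

Set Implicit Arguments.
Unset Strict Implicit.
Unset Printing Implicit Defensive.

Import Order.TTheory GRing.Theory Num.Theory.

Local Open Scope classical_set_scope.
Local Open Scope ring_scope.

(** Every positive x in K = k((G))_kappa is uniquely g r (1 + e) with g in G, r > 0
    in k and e infinitesimal, and log x is the sum of log g, log r and log (1 + e),
    which are purely infinite, constant and infinitesimal. Hence 1 < x and 0 < log x
    are decided by the same lexicographic comparison of three components.

    For log g: an omega-map identifies G with K as ordered groups, so that every
    g is omega of a series with exponents in G. The order isomorphism from K onto
    its positive half-line (1 + x for x >= 0, 1 / (1 - x) for x < 0) transports to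
    an order isomorphism from G onto the part of G above 1; moving the exponents
    of that series along it gives an ordered group isomorphism from G onto the
    purely infinite series.

    For log (1 + e): the exponential series is multiplicative on infinitesimals, by
    the Cauchy product, and injective, since exp e = 1 + e (1 + w) with w
    infinitesimal. Moreover exp (log (1 + e)) = 1 + e, because exp (log (1 + X)) and
    1 + X solve the same differential equation (1 + X) y' = y. So log (1 + e) inverts
    exp and is a bijective homomorphism. These identities between sums of series are
    checked modulo the powers of the ideal generated by the support of e, whose
    intersection is 0. *)

Section TruncatedExpLog.
Variable F : numFieldType.
Implicit Types (p w : {poly F}) (m i : nat).

Lemma dvdp_XnP m p : reflect (forall i, (i < m)%N -> p`_i = 0) ('X^m %| p).
Proof.
apply: (iffP (dvdpP _ _)) => [[q ->] i im|p0]; first by rewrite coefMXn im.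
exists (drop_poly m p); rewrite -[LHS](poly_take_drop m).
suff -> : take_poly m p = 0 by rewrite add0r.
by apply/polyP => i; rewrite coef_take_poly coef0; case: ifP => // /p0.
Qed.

Lemma dvdp_Xn_deriv m p : p`_0 = 0 -> 'X^m %| p^`() -> 'X^(m.+1) %| p.
Proof.
move=> p0 /dvdp_XnP p'0; apply/dvdp_XnP => -[|i] // /p'0 /eqP.
by rewrite coef_deriv mulrn_eq0 => /eqP.
Qed.

Lemma dvdp_Xn_ode m w :
  w`_0 = 0 -> 'X^m %| (1 + 'X) * w^`() - w -> 'X^(m.+1) %| w.
Proof.
move=> w0 ode; have coX i : coprimep 'X^i (1 + 'X : {poly F}).
  by rewrite coprimep_sym coprimep_expr // coprimepX rootE !hornerE oner_eq0.
suff: forall i, (i <= m)%N -> 'X^(i.+1) %| w by apply.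
elim=> [|i IH] im; apply: dvdp_Xn_deriv; rewrite ?expr0 ?dvd1p //.
rewrite -(Gauss_dvdpr _ (coX _)) -[_ * _](subrK w).
by apply: dvdp_add (IH (ltnW im)); apply: dvdp_trans ode; apply: dvdp_exp2l.
Qed.

(* At i = 0 the division by 0 gives 0. *)
Definition log1p_coef i : F := (-1) ^+ i.+1 / i%:R.
Definition exp_coef i : F := i`!%:R^-1.
Definition log1p_poly m : {poly F} := \poly_(i < m) log1p_coef i.
Definition exp_poly m : {poly F} := \poly_(i < m) exp_coef i.

Lemma log1p_coef0 : log1p_coef 0 = 0.
Proof. by rewrite /log1p_coef invr0 mulr0. Qed.

Lemma exp_coefM i n : (i <= n)%N ->
  exp_coef i * exp_coef (n - i) = exp_coef n *+ 'C(n, i).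
Proof.
move=> ni; rewrite /exp_coef -(bin_fact ni) -[RHS]mulr_natl !natrM !invfM.
by rewrite mulVKf // pnatr_eq0 -lt0n bin_gt0.
Qed.

Lemma dvdp_X_log1p_poly m : 'X %| log1p_poly m.
Proof.
rewrite -['X]expr1; apply/dvdp_XnP => -[|//] _.
by rewrite coef_poly log1p_coef0 if_same.
Qed.

Lemma deriv_log1p_poly m :
  (1 + 'X) * (log1p_poly m.+1)^`() = 1 - (- 'X) ^+ m.
Proof.
have -> : (log1p_poly m.+1)^`() = \sum_(i < m) (- 'X) ^+ i.
  have -> : \sum_(i < m) (- 'X) ^+ i = \poly_(i < m) (-1) ^+ i :> {poly F}.
    rewrite poly_def; apply: eq_bigr => i _.
    by rewrite -mul_polyC polyC_exp polyCN exprNn.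
  apply/polyP => i; rewrite coef_deriv !coef_poly ltnS; case: ifP => _.
    by rewrite -[LHS]mulr_natr divfK ?pnatr_eq0 // !exprS !mulN1r opprK.
  exact: mul0rn.
by rewrite -[RHS]opprB subrX1; ring.
Qed.

Lemma deriv_exp_poly m : (exp_poly m.+1)^`() = exp_poly m.
Proof.
apply/polyP => i; rewrite coef_deriv !coef_poly ltnS; case: ifP => _.
  by rewrite /exp_coef factS natrM invfM -[LHS]mulr_natl mulVKf // pnatr_eq0.
exact: mul0rn.
Qed.

Lemma exp_polyS m : exp_poly m.+1 = exp_poly m + exp_coef m *: 'X^m.
Proof. by rewrite /exp_poly !poly_def big_ord_recr. Qed.

Lemma dvdp_exp_poly_log1p m :
  'X^m %| exp_poly m \Po log1p_poly m - (1 + 'X).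
Proof.
case: m => [|m]; first by rewrite expr0 dvd1p.
set l := log1p_poly _; set w := _ - _.
have lX : 'X^m %| l ^+ m by exact/dvdp_exp2r/dvdp_X_log1p_poly.
have l0 : l.[0] = 0 by apply/rootP; rewrite -dvdp_XsubCl subr0 dvdp_X_log1p_poly.
apply: dvdp_Xn_ode.
  rewrite -horner_coef0 /w hornerD hornerN horner_comp l0 horner_coef0 coef_poly.
  by rewrite !hornerE /exp_coef fact0 invr1 subrr.
have -> : (1 + 'X) * w^`() - w =
    - ((exp_poly m \Po l) * (- 'X) ^+ m) - exp_coef m *: l ^+ m.
  rewrite /w derivB deriv_comp derivD derivX derivC deriv_exp_poly exp_polyS.
  rewrite comp_polyD comp_polyZ comp_Xn_poly.
  transitivity ((exp_poly m \Po l) * ((1 + 'X) * l^`()) - (exp_poly m \Po l)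
    - exp_coef m *: l ^+ m); first by ring.
  by rewrite deriv_log1p_poly; ring.
rewrite exprNn -mul_polyC.
by apply: dvdp_sub; rewrite ?dvdpNr !dvdp_mull.
Qed.

End TruncatedExpLog.

Section LeadingExponent.
Context (k : realFieldType) (d : Order.disp_t) (G : orderedAbelianGroupType d).
Context (d' : Order.disp_t) (kappa : orderType d').
Context (kreg : regular_uncountable_cardinal kappa).
Local Notation K := (hahn k G kreg).
Implicit Types (x y e p : K) (g h : G) (r c : k).

Lemma hahn_constE r g : (hahn_const r : K) g = if g == 1%g then r else 0.
Proof. by []. Qed.

Lemma coef_hahn_constM r x g : (hahn_const r * x) g = r * x g.
Proof. by rewrite hahn_term_mulE invg1 mul1g. Qed.

Fact hahn_const_zmod_morphism :
  {morph hahn_const : r c / r - c >-> (r - c : K)}.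
Proof.
move=> r c; apply/hahnP => g; rewrite hahn_coefB !hahn_constE.
by case: ifP; rewrite ?subr0.
Qed.

HB.instance Definition _ :=
  GRing.isZmodMorphism.Build k K hahn_const hahn_const_zmod_morphism.

Fact hahn_const_monoid_morphism : GRing.monoid_morphism (hahn_const : k -> K).
Proof.
split=> // r c; apply/hahnP => g; rewrite coef_hahn_constM !hahn_constE.
by case: ifP; rewrite ?mulr0.
Qed.

HB.instance Definition _ :=
  GRing.isMonoidMorphism.Build k K hahn_const hahn_const_monoid_morphism.

Lemma hahn_termM g h r c :
  hahn_term (g * h)%g (r * c) = hahn_term g r * hahn_term h c :> K.
Proof.
apply/hahnP => j; rewrite hahn_term_mulE /=.
rewrite -(inj_eq (mulgI g) (g^-1 * j)%g h) mulVKg.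
by case: ifP; rewrite ?mulr0.
Qed.

Definition leading_exponent x g : Prop :=
  x g != 0 /\ forall h, (g < h)%O -> x h = 0.

Lemma leading_exponent_gt0 x g : leading_exponent x g -> (0 < x) = (0 < x g).
Proof.
move=> [xg0 xg]; apply/hahn_lt0P/idP => [[h [xh hx]]|]; last by exists g.
case: (ltgtP g h) => [/xg xh0|/hx xg'|->//]; first by rewrite xh0 ltxx in xh.
by rewrite xg' eqxx in xg0.
Qed.

Lemma leading_exponentD x y g : leading_exponent x g ->
  (forall h, (g <= h)%O -> y h = 0) -> leading_exponent (x + y) g.
Proof.
move=> [xg0 xg] yg; split=> [|h gh]; rewrite hahn_coefD yg ?addr0 //.
  exact: xg.
exact: ltW.
Qed.

Definition infinitesimal : {pred K} :=
  fun x => `[< forall g, x g != 0 -> (g < 1%g)%O >].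

Lemma infinitesimalP x :
  reflect (forall g, x g != 0 -> (g < 1%g)%O) (x \in infinitesimal).
Proof. exact: asboolP. Qed.

Lemma infinitesimal_coef0 e g : e \in infinitesimal -> (1%g <= g)%O -> e g = 0.
Proof.
move=> /infinitesimalP e1 g1; apply/eqP/negPn/negP => /e1.
by rewrite ltNge g1.
Qed.

Fact infinitesimal_zmod_closed : zmod_closed infinitesimal.
Proof.
split=> [|x y ix iy]; apply/infinitesimalP => g; first by rewrite eqxx.
rewrite ltNge; apply: contraNN => g1.
by rewrite hahn_coefB !infinitesimal_coef0 ?subrr.
Qed.

HB.instance Definition _ :=
  GRing.isZmodClosed.Build K infinitesimal infinitesimal_zmod_closed.

Lemma infinitesimalM x y :
  x \in infinitesimal -> y \in infinitesimal -> x * y \in infinitesimal.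
Proof.
move=> /infinitesimalP x1 /infinitesimalP y1; apply/infinitesimalP => g.
move=> /cauchy_product_gprod[a [b [/x1 a1 /y1 b1 ->]]].
by apply: le_lt_trans b1; rewrite -[leRHS]mul1g oag_leM // ltW.
Qed.

Lemma infinitesimal_constM r e :
  e \in infinitesimal -> hahn_const r * e \in infinitesimal.
Proof.
move=> /infinitesimalP e1; apply/infinitesimalP => g.
by rewrite coef_hahn_constM mulf_eq0 negb_or => /andP[_ /e1].
Qed.

Lemma leading_exponent_const c e : c != 0 -> e \in infinitesimal ->
  leading_exponent (hahn_const c + e) 1%g.
Proof.
move=> c0 ie; apply: leading_exponentD => [|h]; last exact: infinitesimal_coef0.
by split=> [|h h1]; rewrite hahn_constE ?eqxx // gt_eqF.
Qed.

Lemma purely_infinite_decomp_gt0 p c e : purely_infinite p -> e \in infinitesimal ->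
  (0 < p + (hahn_const c + e)) =
  if p == 0 then if c == 0 then 0 < e else 0 < c else 0 < p.
Proof.
move=> ip ie; have [->|p0] := eqVneq p 0; rewrite ?add0r.
  have [->|c0] := eqVneq c 0; first by rewrite rmorph0 add0r.
  rewrite (leading_exponent_gt0 (leading_exponent_const c0 ie)) hahn_coefD.
  by rewrite hahn_constE eqxx (infinitesimal_coef0 ie) ?addr0.
have [g pg gP] := hahn_lead p0; have pl : leading_exponent p g by [].
have low h : (g <= h)%O -> (hahn_const c + e) h = 0.
  move=> /(lt_le_trans (ip g pg)) h1.
  by rewrite hahn_coefD hahn_constE gt_eqF // add0r infinitesimal_coef0 // ltW.
rewrite (leading_exponent_gt0 (leading_exponentD pl low)).
by rewrite hahn_coefD low // addr0 (leading_exponent_gt0 pl).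
Qed.

Lemma purely_infinite_decomp x : exists p c e,
  [/\ purely_infinite p, e \in infinitesimal & x = p + (hahn_const c + e)].
Proof.
have part (P : pred G) : hahn_support kappa (fun g => if P g then x g else 0).
  apply: (mkhahn_subproof kreg (supp_rwo (x := x)) (supp_small (x := x))).
  by move=> g; case: ifP => // _; rewrite eqxx.
exists (Hahn kreg (part (fun g => 1%g < g)%O)), (x 1%g),
  (Hahn kreg (part (fun g => g < 1%g)%O)); split.
- by move=> g /=; case: ifP => //; rewrite eqxx.
- by apply/infinitesimalP => g /=; case: ifP => //; rewrite eqxx.
apply/hahnP => g; rewrite !hahn_coefD hahn_constE /=.
by case: (ltgtP g 1%g) => [||->]; rewrite ?addr0 ?add0r.
Qed.

Definition polar g r e : K := hahn_term g r * (1 + e).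

Lemma hahn_const_polar r : hahn_const r = polar 1%g r 0.
Proof. by rewrite /polar addr0 mulr1. Qed.

Lemma polarM g h r c x y :
  polar g r x * polar h c y = polar (g * h)%g (r * c) (x + y + x * y).
Proof.
by rewrite /polar hahn_termM; move: (hahn_term g r) (hahn_term h c) => u v; ring.
Qed.

Lemma polar_coef g r e : e \in infinitesimal -> polar g r e g = r.
Proof.
move=> ie; rewrite /polar hahn_term_mulE mulVg hahn_coefD hahn_coef1 eqxx.
by rewrite (infinitesimal_coef0 ie) // addr0 mulr1.
Qed.

Lemma leading_exponent_polar g r e :
  r != 0 -> e \in infinitesimal -> leading_exponent (polar g r e) g.
Proof.
move=> r0 ie; split=> [|h gh]; first by rewrite polar_coef.
have h1 : (1%g < (g^-1 * h)%g)%O by rewrite -(mulVg g) oag_ltM2l.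
rewrite /polar hahn_term_mulE hahn_coefD hahn_coef1 gt_eqF // add0r.
by rewrite (infinitesimal_coef0 ie) ?mulr0 // ltW.
Qed.

Lemma polar_gt0 g r e : 0 < r -> e \in infinitesimal -> 0 < polar g r e.
Proof.
move=> r0 ie; have lead := leading_exponent_polar g (lt0r_neq0 r0) ie.
by rewrite (leading_exponent_gt0 lead) polar_coef.
Qed.

Lemma infinitesimal_1D_gt0 e : e \in infinitesimal -> 0 < 1 + e.
Proof.
move=> ie; have := polar_gt0 1%g ltr01 ie.
by rewrite /polar -/(hahn_const 1) rmorph1 mul1r.
Qed.

Lemma polar_exists x : 0 < x -> exists g r e,
  [/\ 0 < r, e \in infinitesimal & x = polar g r e].
Proof.
move=> x0; have [g xg gP] := hahn_lead (lt0r_neq0 x0).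
exists g, (x g), (hahn_term g^-1%g (x g)^-1 * x - 1); split.
- by rewrite -(leading_exponent_gt0 (conj xg gP)).
- apply/infinitesimalP => h; rewrite ltNge; apply: contraNN => h1.
  rewrite hahn_coefB hahn_coef1 hahn_term_mulE invgK; move: h1.
  rewrite le_eqVlt => /orP[/eqP<-|h1]; first by rewrite mulg1 mulVf ?eqxx ?subrr.
  rewrite (gt_eqF h1) (gP (g * h)%g) ?mulr0 ?subrr //.
  by rewrite -[X in (X < _)%O]mulg1 oag_ltM2l.
- rewrite /polar addrC subrK mulrA -hahn_termM mulgV divff //.
  by rewrite -[hahn_term _ _]/(1 : K) mul1r.
Qed.

Lemma polar_inj g h r c x y : 0 < r -> 0 < c ->
  x \in infinitesimal -> y \in infinitesimal ->
  polar g r x = polar h c y -> [/\ g = h, r = c & x = y].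
Proof.
move=> r0 c0 ix iy eq_polar.
have [rl0 gl] := leading_exponent_polar g (lt0r_neq0 r0) ix.
have [cl0 hl] := leading_exponent_polar h (lt0r_neq0 c0) iy.
have gh : g = h.
  case: (ltgtP g h) => // [/gl|/hl] l0; first by rewrite -eq_polar l0 eqxx in cl0.
  by rewrite eq_polar l0 eqxx in rl0.
have rc : r = c by rewrite -(polar_coef g r ix) eq_polar gh polar_coef.
split=> //; apply: (addrI 1); apply: (@mulfI _ (hahn_term g r)); last first.
  by rewrite -[LHS]/(polar g r x) eq_polar gh rc.
by apply: contra_neq rl0; rewrite /polar => ->; rewrite mul0r.
Qed.

Lemma polar_gt1 g r e : 0 < r -> e \in infinitesimal ->
  (1 < polar g r e) =
  if g == 1%g then if r == 1 then 0 < e else 1 < r else (1%g < g)%O.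
Proof.
move=> r0 ie; have lead := leading_exponent_polar g (lt0r_neq0 r0) ie.
case: (ltgtP g 1%g) => [g1|g1|->]; last 1 first.
- rewrite -subr_gt0.
  have -> : polar 1%g r e - 1 = 0 + (hahn_const (r - 1) + hahn_const r * e).
    by rewrite rmorphB rmorph1 /polar -/(hahn_const r); ring.
  rewrite purely_infinite_decomp_gt0 ?infinitesimal_constM //; last first.
    by move=> h; rewrite eqxx.
  rewrite eqxx subr_eq0 subr_gt0; case: eqP => // ->.
  by rewrite rmorph1 mul1r.
- apply: lt_gtF; rewrite -subr_gt0 -(rmorph1 hahn_const).
  rewrite (leading_exponent_gt0 (leading_exponent_const (oner_neq0 k) _)).
    by rewrite hahn_coefB lead.2 // subr0 hahn_constE eqxx ltr01.
  rewrite rpredN; apply/infinitesimalP => h; rewrite ltNge; apply: contraNN => h1.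
  by rewrite lead.2 // (lt_le_trans g1).
- rewrite -subr_gt0.
  have low h : (g <= h)%O -> (- 1 : K) h = 0.
    by move=> gh; rewrite hahn_coefN hahn_coef1 gt_eqF ?oppr0 // (lt_le_trans g1).
  rewrite (leading_exponent_gt0 (leading_exponentD lead low)) hahn_coefD low //.
  by rewrite addr0 polar_coef.
Qed.

Lemma hahn_prec1_infinitesimal e : hahn_prec e 1 -> e \in infinitesimal.
Proof.
move=> e1; apply/infinitesimalP => h eh.
have /polar_exists[g [r [u [r0 iu eE]]]] : 0 < `|e|.
  by rewrite normr_gt0; apply: contra_neq eh => ->.
have g1 : (g < 1%g)%O.
  (* The leading coefficient of |e| is r; multiplied by 2 / r it exceeds 1. *)
  have := e1 (2 / r) (divr_gt0 (ltr0n _ 2) r0); rewrite normr1 eE.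
  rewrite hahn_const_polar polarM mul1g add0r mul0r addr0 divfK ?lt0r_neq0 //.
  move=> /lt_gtF; rewrite polar_gt1 ?ltr0n // (eqr_nat k 2 1) ltr1n.
  by case: (ltgtP g 1%g).
apply: le_lt_trans g1; rewrite leNgt; apply/negP => gh.
have [_ /(_ h gh)] := leading_exponent_polar g (lt0r_neq0 r0) iu; rewrite -eE.
by case: (ger0P e) => _ /eqP; rewrite ?hahn_coefN ?oppr_eq0 (negPf eh).
Qed.

End LeadingExponent.

Arguments infinitesimal {k d G d' kappa kreg}.

Lemma sum_triangle (V : nmodType) (f : nat -> nat -> V) m :
  \sum_(n < m) \sum_(i < n.+1) f i (n - i)%N = \sum_(i < m) \sum_(j < m - i) f i j.
Proof.
elim: m => [|m IH]; first by rewrite !big_ord0.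
rewrite big_ord_recr IH [RHS]big_ord_recr /= subSnn big_ord1.
rewrite big_ord_recr /= addrA subnn.
congr (_ + _); rewrite -big_split; apply: eq_bigr => i _.
by rewrite subSn ?big_ord_recr // ltnW.
Qed.

Section GroupPowers.
Context (d : Order.disp_t) (G : orderedAbelianGroupType d).
Implicit Types (g h : G) (m n : nat) (E : set G).

Lemma gpow_mul E m n g h :
  gpow E m g -> gpow E n h -> gpow E (m + n) (g * h)%g.
Proof.
elim: m g => [|m IH] g /=; first by move=> ->; rewrite mul1g.
move=> [a [b [Ea Eb ->]]] Eh; exists a, (b * h)%g.
by rewrite mulgA; split=> //; apply: IH.
Qed.

Lemma gpow_lt1 E n g :
  (forall h, E h -> (h < 1%g)%O) -> gpow E n.+1 g -> (g < 1%g)%O.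
Proof.
move=> E1; elim: n g => [|n IH] g [a [b [/E1 a1 Eb ->]]]; first by rewrite Eb mulg1.
by apply: lt_trans (IH _ Eb); rewrite -[ltRHS]mul1g ![(_ * b)%g]oag_mulC oag_ltM2l.
Qed.

End GroupPowers.

Section PowerSeries.
Context (k : realFieldType) (d : Order.disp_t) (G : orderedAbelianGroupType d).
Context (d' : Order.disp_t) (kappa : orderType d').
Context (kreg : regular_uncountable_cardinal kappa).
Local Notation K := (hahn k G kreg).
Implicit Types (x y a b e s : K) (g h : G) (r : k) (n m : nat) (u v : nat -> K).
Implicit Types (c : nat -> k) (p : {poly k}).

Lemma hahn_sum_coef u s g n : hahn_sum u s ->
  (forall i, (n <= i)%N -> u i g = 0) -> s g = (\sum_(i < n) u i) g.
Proof.
move=> [_ _ ->] u0; rewrite hahn_coef_sum (fsbig_ord _ _ (fun i => u i g)).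
by apply/esym/fsbig_widen => // i /= [_ /negP]; rewrite -leqNgt; apply: u0.
Qed.

Lemma hahn_sum_exists u :
  reverse_well_ordered (\bigcup_n support_set (u n)) ->
  (forall g, finite_set [set n | u n g != 0]) -> exists s, hahn_sum u s.
Proof.
move=> ru fu; pose f g := \sum_(n \in [set: nat]) u n g.
have fP : hahn_support kappa f.
  apply: (mkhahn_subproof kreg ru) => [|g].
    apply: small_bigcup => // [|n _]; last exact: supp_small.
    exact: small_countable kreg _ _ _.
  apply: contraNP => ng; rewrite /f fsbig1 // => n _.
  by apply/eqP/negPn/negP => ung; apply: ng; exists n.
by exists (Hahn kreg fP).
Qed.

Definition series_term c e n : K := hahn_const (c n) * e ^+ n.
Definition power_series c e : K := xget 0 [set s | hahn_sum (series_term c e) s].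

Local Notation horner_const p x := (map_poly hahn_const p).[x].

Lemma sum_series_term c e n :
  \sum_(i < n) series_term c e i = horner_const (\poly_(i < n) c i) e.
Proof.
have -> : map_poly hahn_const (\poly_(i < n) c i) =
    \poly_(i < n) (hahn_const (c i) : K).
  by apply/polyP => i; rewrite coef_map !coef_poly; case: ifP; rewrite //= rmorph0.
by rewrite horner_poly.
Qed.

Section Filtration.
Variable E : set G.

Definition filtration n : {pred K} :=
  fun x => `[< forall g, x g != 0 -> exists2 m, (n <= m)%N & gpow E m g >].

Lemma filtrationP n x :
  reflect (forall g, x g != 0 -> exists2 m, (n <= m)%N & gpow E m g)
    (x \in filtration n).
Proof. exact: asboolP. Qed.

Fact filtration_zmod_closed n : zmod_closed (filtration n).
Proof.
split=> [|x y /filtrationP nx /filtrationP ny]; apply/filtrationP => g.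
  by rewrite eqxx.
rewrite hahn_coefB; have [->|/nx//] := eqVneq (x g) 0.
by rewrite sub0r oppr_eq0 => /ny.
Qed.

HB.instance Definition _ n :=
  GRing.isZmodClosed.Build K (filtration n) (filtration_zmod_closed n).

Lemma filtration_leq n m x : (n <= m)%N -> x \in filtration m -> x \in filtration n.
Proof.
move=> nm /filtrationP xm; apply/filtrationP => g /xm[j mj Ej].
by exists j => //; apply: leq_trans mj.
Qed.

Lemma filtrationM n m x y :
  x \in filtration n -> y \in filtration m -> x * y \in filtration (n + m).
Proof.
move=> /filtrationP nx /filtrationP my; apply/filtrationP => g.
move=> /cauchy_product_gprod[a [b [/nx[i ni Ea] /my[j mj Eb] ->]]].
by exists (i + j)%N; [exact: leq_add|exact: gpow_mul].
Qed.

Lemma filtration_const r : hahn_const r \in filtration 0.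
Proof.
apply/filtrationP => g; rewrite hahn_constE.
by case: (eqVneq g 1%g) => [->|_]; [exists 0%N|rewrite eqxx].
Qed.

Lemma filtration_supp x : support_set x `<=` E -> x \in filtration 1.
Proof.
move=> xE; apply/filtrationP => g xg; exists 1%N => //; exists g, 1%g.
by rewrite mulg1; split=> //; apply: xE.
Qed.

Lemma filtrationX m n x : x \in filtration m -> x ^+ n \in filtration (m * n).
Proof.
move=> xm; elim: n => [|n IH]; last by rewrite exprS mulnS filtrationM.
by rewrite muln0 expr0 -(rmorph1 hahn_const) filtration_const.
Qed.

Lemma filtration_series_term c e n :
  e \in filtration 1 -> series_term c e n \in filtration n.
Proof.
move=> e1; apply: (@filtrationM 0); first exact: filtration_const.
by rewrite -[n in filtration n]mul1n filtrationX.
Qed.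

Lemma horner_const_filtration p x :
  x \in filtration 0 -> horner_const p x \in filtration 0.
Proof.
move=> x0; rewrite horner_coef rpred_sum // => i _; rewrite coef_map.
by rewrite (@filtrationM 0 0) ?filtration_const ?(@filtrationX 0).
Qed.

Lemma horner_const_dvdp p m x :
  x \in filtration 1 -> 'X^m %| p -> horner_const p x \in filtration m.
Proof.
move=> x1 /dvdpP[q ->]; rewrite rmorphM hornerM /= map_polyXn hornerXn.
apply: (@filtrationM 0); last by rewrite -[m in filtration m]mul1n filtrationX.
exact/horner_const_filtration/(filtration_leq _ x1).
Qed.

Lemma horner_const_congr p m a b : a \in filtration 0 -> b \in filtration 0 ->
  a - b \in filtration m -> horner_const p a - horner_const p b \in filtration m.
Proof.
move=> a0 b0 ab; rewrite !horner_coef -sumrB rpred_sum // => i _.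
rewrite -mulrBr coef_map; apply: (@filtrationM 0); first exact: filtration_const.
rewrite subrXX -[m]addn0; apply: filtrationM => //; apply: rpred_sum => j _.
by apply: (@filtrationM 0 0); apply: (@filtrationX 0).
Qed.

Hypotheses (rE : reverse_well_ordered E) (E1 : forall g, E g -> (g < 1%g)%O).

Lemma filtration_eq0 x : (forall n, x \in filtration n) -> x = 0.
Proof.
move=> xn; apply/hahnP => g; apply/eqP/negPn/negP => xg.
have [N NP] := gpow_fin g rE E1; have [m Nm] := filtrationP _ _ (xn N) g xg.
exact: NP.
Qed.

Lemma filtration1_infinitesimal e : e \in filtration 1 -> e \in infinitesimal.
Proof.
by move=> /filtrationP e1; apply/infinitesimalP => g /e1[[//|n] _ /(gpow_lt1 E1)].
Qed.

Definition adic_sum u s : Prop :=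
  forall n, s - \sum_(i < n) u i \in filtration n.

Lemma adic_sum_uniq u x y : adic_sum u x -> adic_sum u y -> x = y.
Proof.
move=> ux uy; apply/eqP; rewrite -subr_eq0; apply/eqP/filtration_eq0 => n.
by rewrite -(subrKA (\sum_(i < n) u i)) rpredD // -opprB rpredN; apply: uy.
Qed.

Lemma hahn_sum_filtration_exists u :
  (forall n, u n \in filtration n) -> exists s, hahn_sum u s.
Proof.
move=> un; apply: hahn_sum_exists => [|g].
  apply: rwo_sub (rwo_gmonoid rE E1) => g [n _] /(filtrationP _ _ (un n))[m _ gm].
  by exists m.
have [N gN] := gpow_fin g rE E1.
apply: sub_finite_set (finite_II N) => n /= /(filtrationP _ _ (un n))[m nm].
by rewrite ltnNge; apply: contraPN => Nn; apply/gN/(leq_trans Nn).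
Qed.

Lemma hahn_sum_adic u s :
  (forall n, u n \in filtration n) -> hahn_sum u s <-> adic_sum u s.
Proof.
move=> un.
have hahn_adic x : hahn_sum u x -> adic_sum u x.
  move=> ux n; apply/filtrationP => g; rewrite hahn_coefB subr_eq0 => neq.
  apply: contrapT => low; move/eqP: neq; apply; apply: (hahn_sum_coef ux) => i ni.
  apply/eqP/negPn/negP => /(filtrationP _ _ (un i))[m im gm].
  by apply: low; exists m => //; apply: leq_trans im.
split=> [|us]; first exact: hahn_adic.
have [x ux] := hahn_sum_filtration_exists un.
by rewrite (adic_sum_uniq us (hahn_adic x ux)).
Qed.

Lemma adic_sumM u v x y :
  (forall n, u n \in filtration n) -> (forall n, v n \in filtration n) ->
  adic_sum u x -> adic_sum v y ->
  adic_sum (fun n => \sum_(i < n.+1) u i * v (n - i)%N) (x * y).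
Proof.
move=> un vn ux vy n; rewrite (sum_triangle (fun i j => u i * v j)).
have y0 : y \in filtration 0 by have := vy 0; rewrite big_ord0 subr0.
have -> : x * y - \sum_(i < n) \sum_(j < n - i) u i * v j =
    (x - \sum_(i < n) u i) * y + \sum_(i < n) u i * (y - \sum_(j < n - i) v j).
  rewrite mulrBl mulr_suml -addrA; congr (_ + _).
  rewrite [RHS]addrC -sumrB -sumrN; apply: eq_bigr => i _.
  by rewrite mulrBr mulr_sumr addrAC subrr add0r.
apply: rpredD; first by have := filtrationM (ux n) y0; rewrite addn0.
apply: rpred_sum => i _; have := filtrationM (un i) (vy (n - i)%N).
by rewrite subnKC // ltnW.
Qed.

Lemma power_series_adic c e :
  e \in filtration 1 -> adic_sum (series_term c e) (power_series c e).
Proof.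
move=> e1; have un n := @filtration_series_term c e n e1.
apply/(hahn_sum_adic _ un).
exact: (xgetPex 0 (hahn_sum_filtration_exists un)).
Qed.

Lemma power_series_filtration0 c e :
  e \in filtration 1 -> power_series c e \in filtration 0.
Proof. by move=> e1; have := power_series_adic c e1 0; rewrite big_ord0 subr0. Qed.

Lemma power_series_recl c e : e \in filtration 1 ->
  power_series c e = hahn_const (c 0) + e * power_series (fun n => c n.+1) e.
Proof.
move=> e1; apply: (adic_sum_uniq (power_series_adic c e1)) => -[|n].
  rewrite big_ord0 subr0 rpredD ?filtration_const // (@filtrationM 0 0) //.
    exact: filtration_leq e1.
  exact: power_series_filtration0.
rewrite big_ord_recl /series_term expr0 mulr1.
under eq_bigr => i _ do rewrite lift0 exprS mulrCA.
rewrite -mulr_sumr opprD addrA [_ + e * _]addrC addrK -mulrBr -add1n.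
exact: filtrationM (power_series_adic _ e1 n).
Qed.

Lemma power_series_comp c p x e m : x \in filtration 1 -> e \in filtration 1 ->
  x - horner_const p e \in filtration m ->
  power_series c x - horner_const (\poly_(i < m) c i \Po p) e \in filtration m.
Proof.
move=> x1 e1 xp; rewrite map_comp_poly horner_comp.
rewrite -(subrKA (horner_const (\poly_(i < m) c i) x)) -sum_series_term.
rewrite rpredD ?(power_series_adic c x1) // sum_series_term.
apply: horner_const_congr xp; first exact: filtration_leq x1.
exact/horner_const_filtration/(filtration_leq _ e1).
Qed.

End Filtration.

Lemma infinitesimal_filtration e : e \in infinitesimal ->
  [/\ reverse_well_ordered (support_set e),
      forall g, support_set e g -> (g < 1%g)%O &
      e \in filtration (support_set e) 1].
Proof.
move=> /infinitesimalP ie; split=> //; first exact: supp_rwo.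
exact: filtration_supp.
Qed.

Lemma power_series_expand c e : c 1 = 1 -> e \in infinitesimal ->
  exists2 w, w \in infinitesimal & power_series c e = hahn_const (c 0) + e * (1 + w).
Proof.
move=> c1 ie; have [rE E1 e1] := infinitesimal_filtration ie.
exists (e * power_series (fun n => c n.+2) e); last first.
  by rewrite 2!(power_series_recl rE E1 _ e1) c1 rmorph1.
apply: (filtration1_infinitesimal E1); apply: (@filtrationM _ 1 0) => //.
exact: power_series_filtration0.
Qed.

Definition hahn_exp e : K := power_series (@exp_coef k) e.
Definition hahn_log1p e : K := power_series (@log1p_coef k) e.

Lemma hahn_expD a b : a \in infinitesimal -> b \in infinitesimal ->
  hahn_exp (a + b) = hahn_exp a * hahn_exp b.
Proof.
move=> /infinitesimalP ia /infinitesimalP ib.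
pose E := support_set a `|` support_set b.
have rE : reverse_well_ordered E by apply: rwo_setU; apply: supp_rwo.
have E1 g : E g -> (g < 1%g)%O by case=> [/ia|/ib].
have a1 : a \in filtration E 1 by apply: filtration_supp => g ?; left.
have b1 : b \in filtration E 1 by apply: filtration_supp => g ?; right.
apply: (adic_sum_uniq rE E1 (power_series_adic rE E1 _ (rpredD a1 b1))).
have -> : series_term (@exp_coef k) (a + b) = fun n => \sum_(i < n.+1)
    series_term (@exp_coef k) a i * series_term (@exp_coef k) b (n - i)%N.
  apply/funext => n; rewrite /series_term addrC exprDn mulr_sumr.
  apply: eq_bigr => i _; rewrite mulrACA -rmorphM exp_coefM -1?ltnS //.
  by rewrite rmorphMn mulrnAr mulrnAl [_ * a ^+ _]mulrC.
by apply: adic_sumM => [n|n||]; [exact: filtration_series_term..| |];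
  apply: power_series_adic.
Qed.

Lemma hahn_exp_expand e : e \in infinitesimal ->
  exists2 w, w \in infinitesimal & hahn_exp e = 1 + e * (1 + w).
Proof.
move=> ie; have exp1 : exp_coef k 1 = 1 by rewrite /exp_coef invr1.
have [w iw expE] := power_series_expand exp1 ie; exists w => //.
by rewrite /hahn_exp expE /exp_coef invr1 rmorph1.
Qed.

Lemma hahn_log1p_expand e : e \in infinitesimal ->
  exists2 w, w \in infinitesimal & hahn_log1p e = e * (1 + w).
Proof.
move=> ie; have log1 : log1p_coef k 1 = 1 by rewrite /log1p_coef sqrrN expr1n divr1.
have [w iw logE] := power_series_expand log1 ie; exists w => //.
by rewrite /hahn_log1p logE log1p_coef0 rmorph0 add0r.
Qed.

Lemma hahn_exp_inj : {in infinitesimal &, injective hahn_exp}.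
Proof.
move=> a b ia ib; rewrite -{1}(subrK b a) hahn_expD ?rpredB //.
have [v iv expb] := hahn_exp_expand ib.
have expb0 : hahn_exp b != 0.
  rewrite expb lt0r_neq0 // infinitesimal_1D_gt0 // mulrDr mulr1.
  by rewrite rpredD ?infinitesimalM.
rewrite -[RHS]mul1r => /(mulIf expb0).
have [w iw ->] := hahn_exp_expand (rpredB ia ib).
move/eqP; rewrite -subr_eq0 addrC addKr mulf_eq0 subr_eq0.
by rewrite (gt_eqF (infinitesimal_1D_gt0 iw)) orbF => /eqP.
Qed.

Lemma hahn_log1p_infinitesimal e :
  e \in infinitesimal -> hahn_log1p e \in infinitesimal.
Proof.
move=> ie; have [w iw ->] := hahn_log1p_expand ie.
by rewrite mulrDr mulr1 rpredD ?infinitesimalM.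
Qed.

Lemma hahn_exp_log1p e : e \in infinitesimal -> hahn_exp (hahn_log1p e) = 1 + e.
Proof.
move=> ie; have [rE E1 e1] := infinitesimal_filtration ie.
apply/eqP; rewrite -subr_eq0; apply/eqP/(filtration_eq0 rE E1) => m.
have l1 : hahn_log1p e \in filtration (support_set e) 1.
  rewrite /hahn_log1p (power_series_recl rE E1 _ e1) log1p_coef0 rmorph0 add0r.
  by apply: (@filtrationM _ 1 0) => //; apply: power_series_filtration0.
have lm :
    hahn_log1p e - horner_const (log1p_poly k m) e \in filtration (support_set e) m.
  by rewrite -sum_series_term; apply: power_series_adic.
have explog := power_series_comp rE E1 (@exp_coef k) l1 e1 lm.
have := rpredD explog (horner_const_dvdp e1 (dvdp_exp_poly_log1p k m)).
by rewrite rmorphB hornerD hornerN subrKA rmorphD rmorph1 /= map_polyX !hornerE.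
Qed.

Lemma hahn_log1p0 : hahn_log1p 0 = 0.
Proof.
by have [w _ ->] := hahn_log1p_expand (rpred0 infinitesimal); rewrite mul0r.
Qed.

Lemma hahn_log1pM a b : a \in infinitesimal -> b \in infinitesimal ->
  hahn_log1p (a + b + a * b) = hahn_log1p a + hahn_log1p b.
Proof.
move=> ia ib; have iab : a + b + a * b \in infinitesimal.
  by rewrite !rpredD ?infinitesimalM.
apply: hahn_exp_inj; rewrite ?rpredD ?hahn_log1p_infinitesimal //.
by rewrite hahn_expD ?hahn_log1p_infinitesimal // !hahn_exp_log1p //; ring.
Qed.

Lemma hahn_log1p_surj e : e \in infinitesimal ->
  exists2 u, u \in infinitesimal & hahn_log1p u = e.
Proof.
move=> ie; have [w iw expE] := hahn_exp_expand ie.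
have iu : e * (1 + w) \in infinitesimal.
  by rewrite mulrDr mulr1 rpredD ?infinitesimalM.
exists (e * (1 + w)) => //; apply: hahn_exp_inj; rewrite ?hahn_log1p_infinitesimal //.
by rewrite hahn_exp_log1p.
Qed.

Lemma hahn_log1p_gt0 e : e \in infinitesimal -> (0 < hahn_log1p e) = (0 < e).
Proof.
move=> ie; have [w iw ->] := hahn_log1p_expand ie.
by rewrite pmulr_lgt0 ?infinitesimal_1D_gt0.
Qed.

Lemma hahn_sum_log1p e : e \in infinitesimal ->
  hahn_sum (fun n => (-1) ^+ n.+2 * e ^+ n.+1 / n.+1%:R) (hahn_log1p e).
Proof.
move=> ie; have [rE E1 e1] := infinitesimal_filtration ie.
have -> : (fun n => (-1) ^+ n.+2 * e ^+ n.+1 / n.+1%:R) =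
    fun n => series_term (@log1p_coef k) e n.+1.
  apply/funext => n; rewrite /series_term /log1p_coef rmorphM fmorphV rmorph_nat.
  by rewrite rmorph_sign mulrAC.
have un n : series_term (@log1p_coef k) e n.+1 \in filtration (support_set e) n.
  exact: filtration_leq (leqnSn n) (filtration_series_term _ _ e1).
apply/(hahn_sum_adic rE E1 _ un) => n.
have := power_series_adic rE E1 (@log1p_coef k) e1 n.+1; rewrite big_ord_recl.
rewrite {1}/series_term log1p_coef0 rmorph0 mul0r add0r.
exact: filtration_leq.
Qed.

End PowerSeries.

Section MonotoneImage.
Context (d1 d2 : Order.disp_t) (G : orderType d1) (H : orderType d2).
Variable phi : G -> H.
Hypothesis phi_lt : {homo phi : g h / (g < h)%O}.

Lemma reverse_well_ordered_image (A : set G) :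
  reverse_well_ordered A -> reverse_well_ordered (phi @` A).
Proof.
move=> rA B BA [_ /[dup] /BA[a Aa <-] Ba].
have [_ []//||m [Am Bm] mP] := rA [set g | A g /\ B (phi g)]; first by exists a.
exists (phi m) => // c /[dup] /BA[b Ab <-] Bb.
by rewrite (le_mono phi_lt) mP.
Qed.

Lemma reverse_well_ordered_preimage (B : set H) :
  reverse_well_ordered B -> reverse_well_ordered (phi @^-1` B).
Proof.
move=> rB A AB [a Aa].
have [_ [b /AB ? <-//]||_ [m Am <-] mP] := rB (phi @` A); first by exists (phi a), a.
exists m => // b Ab.
by rewrite -(le_mono phi_lt) mP //; exists b.
Qed.

End MonotoneImage.

Section HahnMap.
Context (k : realFieldType) (d1 d2 : Order.disp_t).
Context (G : orderedAbelianGroupType d1) (H : orderedAbelianGroupType d2).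
Context (d' : Order.disp_t) (kappa : orderType d').
Context (kreg : regular_uncountable_cardinal kappa).
Variable phi : G -> H.
Hypothesis phi_lt : {homo phi : g h / (g < h)%O}.
Let phi_inj : injective phi := inc_inj (le_mono phi_lt).
Implicit Types (x y : hahn k G kreg) (g : G) (h : H).

Definition hahn_map_coef x h : k := xget 0 (x @` (phi @^-1` [set h])).

Lemma hahn_map_coef_image x g : hahn_map_coef x (phi g) = x g.
Proof. by apply: xget_unique => [|_ [a /phi_inj -> <-]]; first exists g. Qed.

Lemma hahn_map_coef_notin x h : ~ range phi h -> hahn_map_coef x h = 0.
Proof. by move=> nh; apply: xgetPN => r [g gh _]; apply: nh; exists g. Qed.

Lemma hahn_map_subproof x : hahn_support kappa (hahn_map_coef x).
Proof.
have rx := reverse_well_ordered_image phi_lt (supp_rwo (x := x)).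
apply: (mkhahn_subproof kreg rx); first exact/small_image/supp_small.
move=> h; have [[g _ <-]|nh] := pselect (range phi h); last first.
  by rewrite hahn_map_coef_notin ?eqxx.
by rewrite hahn_map_coef_image => xg; exists g.
Qed.

Definition hahn_map x : hahn k H kreg := Hahn kreg (hahn_map_subproof x).

Lemma hahn_mapD x y : hahn_map (x + y) = hahn_map x + hahn_map y.
Proof.
apply/hahnP => h; rewrite hahn_coefD /=.
have [[g _ <-]|nh] := pselect (range phi h); first by rewrite !hahn_map_coef_image.
by rewrite !hahn_map_coef_notin ?addr0.
Qed.

Lemma hahn_map_gt0 x : 0 < x -> 0 < hahn_map x.
Proof.
move=> /hahn_lt0P[g [xg gP]]; apply/hahn_lt0P; exists (phi g).
rewrite /= hahn_map_coef_image; split=> // h gh.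
have [[j _ jh]|nh] := pselect (range phi h); last exact: hahn_map_coef_notin.
by rewrite -jh hahn_map_coef_image gP // -(leW_mono (le_mono phi_lt)) jh.
Qed.

Lemma hahn_map_lt : {homo hahn_map : x y / x < y}.
Proof.
by move=> x y xy; rewrite -[y](subrK x) hahn_mapD ltrDr hahn_map_gt0 ?subr_gt0.
Qed.

Lemma range_hahn_map :
  range hahn_map = [set y : hahn k H kreg | support_set y `<=` range phi].
Proof.
apply/seteqP; split=> [_ [x _ <-] h|y yphi].
  have [//|nh] := pselect (range phi h).
  by rewrite /support_set /= hahn_map_coef_notin // eqxx.
have xP : hahn_support kappa (y \o phi).
  have ry := reverse_well_ordered_preimage phi_lt (supp_rwo (x := y)).
  apply: (mkhahn_subproof kreg ry) => //.
  apply: contra_not (supp_small (x := y)) => /card_le_trans; apply.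
  apply: card_le_trans (card_le_inj_image (in2W phi_inj)) _.
  by apply: subset_card_le => _ [g yg <-].
exists (Hahn kreg xP) => //; apply/hahnP => h /=.
have [[g _ <-]|nh] := pselect (range phi h); first by rewrite hahn_map_coef_image.
by rewrite hahn_map_coef_notin //; apply/esym/eqP; apply: contra_notT nh => /yphi.
Qed.

End HahnMap.

Section PositiveHalfLine.
Variable F : realFieldType.
Implicit Types x y : F.

Definition to_pos x : F := if 0 <= x then 1 + x else (1 - x)^-1.

Lemma to_pos_lt : {homo to_pos : x y / x < y}.
Proof.
move=> x y xy; rewrite /to_pos; case: (leP 0 x) => x0; case: (leP 0 y) => y0.
- by rewrite ltrD2l.
- by have := lt_trans xy y0; rewrite ltNge x0.
- apply: (@lt_le_trans _ _ 1); last by rewrite lerDl.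
  by rewrite invf_lt1 ?ltrDl ?oppr_gt0 // addr_gt0 ?oppr_gt0.
- by rewrite ltf_pV2 ?posrE ?subr_gt0 ?(lt_trans _ ltr01) // ltrD2l ltrN2.
Qed.

Lemma range_to_pos : range to_pos = [set y | 0 < y].
Proof.
apply/seteqP; split=> [_ [x _ <-]|y /= y0]; rewrite /to_pos.
  by case: (leP 0 x) => x0; rewrite /= ?invr_gt0 ?subr_gt0 ?ltr_wpDr // (lt_trans x0).
have [y1|y1] := leP 1 y.
  by exists (y - 1); rewrite // subr_ge0 y1 addrC subrK.
by exists (1 - y^-1); rewrite // subr_ge0 invf_le1 // leNgt y1 subKr invrK.
Qed.

End PositiveHalfLine.

Lemma mulg_add_morph1 (G : groupType) (V : zmodType) (f : G -> V) :
  {morph f : g h / (g * h)%g >-> g + h} -> f 1%g = 0.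
Proof. by move=> fM; apply: (addrI (f 1%g)); rewrite -fM mulg1 addr0. Qed.

Section OmegaLogarithm.
Context (k : realFieldType) (d : Order.disp_t) (G : orderedAbelianGroupType d).
Context (d' : Order.disp_t) (kappa : orderType d').
Context (kreg : regular_uncountable_cardinal kappa).
Local Notation K := (hahn k G kreg).
Implicit Types (x y : K) (g h : G) (lam : G -> K).

Lemma monomialM : {morph (monomial : G -> K) : g h / (g * h)%g >-> g * h}.
Proof. by move=> g h; rewrite /monomial -hahn_termM mulr1. Qed.

Lemma monomial_lt : {homo (monomial : G -> K) : g h / (g < h)%O >-> g < h}.
Proof.
move=> g h gh; rewrite -subr_gt0.
have lead : leading_exponent (monomial h : K) h.
  by split=> [|j hj] /=; rewrite ?eqxx ?oner_eq0 // gt_eqF.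
have low j : (h <= j)%O -> (- monomial g : K) j = 0.
  by move=> hj; rewrite hahn_coefN /= gt_eqF ?oppr0 // (lt_le_trans gh).
rewrite (leading_exponent_gt0 (leading_exponentD lead low)) hahn_coefD low //.
by rewrite addr0 /= eqxx ltr01.
Qed.

Definition monomial_log (lam : G -> K) : Prop :=
  [/\ {morph lam : g h / (g * h)%g >-> g + h},
      {homo lam : g h / (g < h)%O >-> g < h} &
      range lam = @purely_infinite k d G d' kappa kreg].

Lemma monomial_log_one lam : monomial_log lam -> lam 1%g = 0.
Proof. by case=> /mulg_add_morph1. Qed.

Lemma monomial_log_eq0 lam g : monomial_log lam -> (lam g == 0) = (g == 1%g).
Proof.
move=> lam_log; have [_ lam_lt _] := lam_log.
by rewrite -(monomial_log_one lam_log) (inj_eq (inc_inj (le_mono lam_lt))).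
Qed.

Lemma monomial_log_gt0 lam g : monomial_log lam -> (0 < lam g) = (1%g < g)%O.
Proof.
move=> lam_log; have [_ lam_lt _] := lam_log.
by rewrite -(monomial_log_one lam_log) (leW_mono (le_mono lam_lt)).
Qed.

Lemma monomial_log_purely_infinite lam g :
  monomial_log lam -> purely_infinite (lam g).
Proof. by move=> [_ _ <-]; exists g. Qed.

Lemma omega_map_iso (omega : K -> K) :
  omega_map (@hahn_monomials k d G d' kappa kreg) omega ->
  exists (v : G -> K) (w : K -> G), [/\ cancel v w, cancel w v,
    {morph v : g h / (g * h)%g >-> g + h} & {homo v : g h / (g < h)%O >-> g < h}].
Proof.
move=> [[oM oI oS] oD olt].
have mono_lt : {mono (monomial : G -> K) : g h / (g < h)%O >-> g < h}.
  exact/leW_mono/le_mono/monomial_lt.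
have /choice[w wP] : forall x, exists g, monomial g = omega x.
  by move=> x; have [g _ <-] := oM x I; exists g.
have wlt : {homo w : x y / x < y >-> (x < y)%O}.
  by move=> x y /olt; rewrite -!wP mono_lt.
have /choice[v vP] : forall g, exists x, omega x = monomial g.
  by move=> g; have [x _ xg] := oS (monomial g) (imageT _ g); exists x.
have vK : cancel v w.
  by move=> g; apply: (inc_inj (le_mono monomial_lt)); rewrite wP vP.
have wK : cancel w v by move=> x; apply: (inc_inj (le_mono wlt)); rewrite vK.
exists v, w; split=> // g h.
  apply: (can_inj wK); rewrite vK; apply: (inc_inj (le_mono monomial_lt)).
  by rewrite monomialM wP oD !vP.
by rewrite -(leW_mono (le_mono wlt)) !vK.
Qed.

Lemma iso_monomial_log (v : G -> K) (w : K -> G) : cancel v w -> cancel w v ->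
  {morph v : g h / (g * h)%g >-> g + h} -> {homo v : g h / (g < h)%O >-> g < h} ->
  exists lam, monomial_log lam.
Proof.
move=> vK wK vM vlt; have v_mono := leW_mono (le_mono vlt).
have v1 := mulg_add_morph1 vM.
have wlt : {homo w : x y / x < y >-> (x < y)%O}.
  by move=> x y xy; rewrite -v_mono !wK.
pose phi g := w (to_pos (v g)).
have phi_lt : {homo phi : g h / (g < h)%O} by move=> g h /vlt/to_pos_lt/wlt.
have phi_range : range phi = [set g | (1%g < g)%O].
  apply/seteqP; split=> [_ [g _ <-]|g /= g1].
    rewrite /= -v_mono v1 wK.
    by have : range (@to_pos K) (to_pos (v g)) by []; rewrite range_to_pos.
  have [x _ xg] : range (@to_pos K) (v g) by rewrite range_to_pos /= -v1 v_mono.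
  by exists (w x); rewrite // /phi wK xg vK.
exists (hahn_map phi_lt \o v); split.
- by move=> g h /=; rewrite vM hahn_mapD.
- by move=> g h /vlt; apply: hahn_map_lt.
have range_v : range v = setT by apply/seteqP; split=> // x _; exists (w x).
by rewrite -(image_comp v) range_v range_hahn_map phi_range.
Qed.

End OmegaLogarithm.

Section ExponentialField.
Context (k : rcfType) (expk logk : k -> k).
Hypothesis kexp : exponential_field expk logk.
Implicit Types r : k.

Lemma exponential_field_exp0 : expk 0 = 1.
Proof.
apply: (@mulfI _ (expk 0)); first by rewrite gt_eqF ?(expk_gt0 kexp).
by rewrite -(expk_add kexp) addr0 mulr1.
Qed.

Lemma exponential_field_log1 : logk 1 = 0.
Proof. by rewrite -exponential_field_exp0 (expkK kexp). Qed.

Lemma exponential_field_logM r s :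
  0 < r -> 0 < s -> logk (r * s) = logk r + logk s.
Proof.
move=> r0 s0; rewrite -[in LHS](logkK kexp r0) -[in LHS](logkK kexp s0).
by rewrite -(expk_add kexp) (expkK kexp).
Qed.

Lemma exponential_field_log_eq0 r : 0 < r -> (logk r == 0) = (r == 1).
Proof.
move=> r0; apply/eqP/eqP => [l0|->]; last exact: exponential_field_log1.
by rewrite -(logkK kexp r0) l0 exponential_field_exp0.
Qed.

Lemma exponential_field_log_gt0 r : 0 < r -> (0 < logk r) = (1 < r).
Proof.
move=> r0; rewrite -{2}(logkK kexp r0) -exponential_field_exp0.
by rewrite (leW_mono (le_mono (expk_lt kexp))).
Qed.

End ExponentialField.

Section AnalyticLogarithm.
Context (k : rcfType) (expk logk : k -> k).
Hypothesis kexp : exponential_field expk logk.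
Context (d : Order.disp_t) (G : orderedAbelianGroupType d).
Context (d' : Order.disp_t) (kappa : orderType d').
Context (kreg : regular_uncountable_cardinal kappa).
Local Notation K := (hahn k G kreg).
Variable lam : G -> K.
Hypothesis lam_log : monomial_log lam.
Let lam_one : lam 1%g = 0 := monomial_log_one lam_log.
Implicit Types (x y e : K) (g h : G) (r : k).

Definition hahn_log x : K := xget 0 [set y | exists g r e,
  [/\ 0 < r, e \in infinitesimal, x = polar g r e &
      y = lam g + (hahn_const (logk r) + hahn_log1p e)]].

Lemma hahn_log_polar g r e : 0 < r -> e \in infinitesimal ->
  hahn_log (polar g r e) = lam g + (hahn_const (logk r) + hahn_log1p e).
Proof.
move=> r0 ie; apply: xget_unique => [|y]; first by exists g, r, e.
by move=> [h [s [f [s0 jf /(polar_inj r0 s0 ie jf)[<- <- <-] ->]]]].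
Qed.

Lemma hahn_logM x y : 0 < x -> 0 < y -> hahn_log (x * y) = hahn_log x + hahn_log y.
Proof.
have [lamM _ _] := lam_log.
move=> /polar_exists[g [r [a [r0 ia ->]]]] /polar_exists[h [s [b [s0 ib ->]]]].
rewrite polarM !hahn_log_polar ?mulr_gt0 ?rpredD ?infinitesimalM //.
rewrite lamM (exponential_field_logM kexp) // rmorphD hahn_log1pM //=.
by rewrite [X in _ + X = _]addrACA [LHS]addrACA.
Qed.

Lemma hahn_log_gt0 x : 0 < x -> (0 < hahn_log x) = (1 < x).
Proof.
move=> /polar_exists[g [r [e [r0 ie ->]]]]; rewrite hahn_log_polar // polar_gt1 //.
rewrite purely_infinite_decomp_gt0 ?hahn_log1p_infinitesimal //; last first.
  exact: (monomial_log_purely_infinite lam_log).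
rewrite (monomial_log_eq0 _ lam_log) (monomial_log_gt0 _ lam_log).
rewrite (exponential_field_log_eq0 kexp) //.
by rewrite (exponential_field_log_gt0 kexp) // hahn_log1p_gt0.
Qed.

Lemma hahn_log_monomial g : hahn_log (monomial g) = lam g.
Proof.
have -> : monomial g = polar g 1 0 :> K by rewrite /polar addr0 mulr1.
rewrite hahn_log_polar ?rpred0 // hahn_log1p0 (exponential_field_log1 kexp).
by rewrite rmorph0 !addr0.
Qed.

Lemma hahn_log_const r : 0 < r -> hahn_log (hahn_const r) = hahn_const (logk r).
Proof.
move=> r0; rewrite hahn_const_polar hahn_log_polar ?rpred0 //.
by rewrite lam_one hahn_log1p0 add0r addr0.
Qed.

Lemma hahn_log_1D e : e \in infinitesimal -> hahn_log (1 + e) = hahn_log1p e.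
Proof.
move=> ie; have -> : 1 + e = polar 1%g 1 e.
  by rewrite /polar -/(hahn_const 1) rmorph1 mul1r.
by rewrite hahn_log_polar // lam_one (exponential_field_log1 kexp) rmorph0 !add0r.
Qed.

Lemma hahn_log_surj y : exists2 x, 0 < x & hahn_log x = y.
Proof.
have [p [c [e [ip ie ->]]]] := purely_infinite_decomp y.
have [_ _ lam_range] := lam_log.
have [g _ <-] : range lam p by rewrite lam_range.
have [u iu <-] := hahn_log1p_surj ie.
exists (polar g (expk c) u); first by rewrite polar_gt0 ?(expk_gt0 kexp).
by rewrite hahn_log_polar ?(expk_gt0 kexp) // (expkK kexp).
Qed.

Lemma hahn_log_analytic : analytic_logarithm logk hahn_log.
Proof.
split.
- exact: hahn_logM.
- move=> x y x0 xy; have yx0 : 0 < y / x by rewrite divr_gt0 // (lt_trans x0).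
  rewrite -[y](divfK (lt0r_neq0 x0)) hahn_logM // ltrDr hahn_log_gt0 //.
  by rewrite ltr_pdivlMr // mul1r.
- exact: hahn_log_surj.
- exact: hahn_log_const.
- move=> e /hahn_prec1_infinitesimal ie.
  by rewrite hahn_log_1D //; apply: hahn_sum_log1p.
- have [_ _ <-] := lam_log; rewrite image_comp.
  by apply: eq_imagel => g _; apply: hahn_log_monomial.
Qed.

End AnalyticLogarithm.

Lemma omega_field_analytic_logarithm (d' : Order.disp_t) (kappa : orderType d')
    (kreg : regular_uncountable_cardinal kappa) (k : rcfType) (expk logk : k -> k)
    (d : Order.disp_t) (G : orderedAbelianGroupType d) :
  exponential_field expk logk -> hahn_omega_field k G kreg ->
  exists log : hahn k G kreg -> hahn k G kreg, analytic_logarithm logk log.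
Proof.
move=> kexp [_ _ _ [omega /omega_map_iso[v [w [vK wK vM v_lt]]]]].
have [lam lam_log] := iso_monomial_log vK wK vM v_lt.
by exists (hahn_log logk lam); exact: (hahn_log_analytic kexp).
Qed.

Lemma realType_exponential_field (R : realType) :
  exponential_field (@expR R) (@ln R).
Proof.
split.
- exact: expRD.
- by move=> a b; rewrite ltr_expR.
- exact: expR_gt0.
- exact: expRK.
- by move=> a a0; apply: lnK; rewrite posrE.
Qed.

Theorem theorem3p4 (d' : Order.disp_t) (kappa : orderType d')
    (kappa_reg : regular_uncountable_cardinal kappa) :
  (forall (R : realType) (d : Order.disp_t) (G : orderedAbelianGroupType d),
     hahn_omega_field R G kappa_reg ->
     exists log : hahn R G kappa_reg -> hahn R G kappa_reg,
       analytic_logarithm (@ln R) log)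
  /\
  (forall (k : rcfType) (expk logk : k -> k), exponential_field expk logk ->
   forall (d : Order.disp_t) (G : orderedAbelianGroupType d),
     hahn_omega_field k G kappa_reg ->
     exists log : hahn k G kappa_reg -> hahn k G kappa_reg,
       analytic_logarithm logk log).
Proof.
split=> [R d G|k expk logk kexp d G].
  exact: (omega_field_analytic_logarithm (realType_exponential_field R)).
exact: (omega_field_analytic_logarithm kexp).
Qed.
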